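(* Consider the nonlinear system $\dot x = f(x)+g(x)u$, $y=h(x)$, $x(0)=x_0$, with $x\in\mathbb{R}^n$, $u,y\in\mathbb{R}^p$ and $f,g,h$ smooth. Assume that (A1) the origin is an equilibrium point of the system; (A2) the system has a well-defined relative degree vector $(\gamma_1,\dots,\gamma_p)$ at $x_0$; (A3) the zero dynamics $\dot\eta=f_0(\eta,0)$ of its normal form is stable. Let $r=Hw\in\mathbb{R}^p$ be a reference signal obtained as the output of the linear exosystem $\dot w=Sw$, $w(0)=w_0\in\mathbb{R}^m$, and let $(x_0,w_0)$ be a known initial condition. Let $$\dot\eta=f_0(\eta,\xi),\qquad \dot\xi=A_c\xi+B_cv,\qquad y=C_c\xi,$$ with $A_c=\mathrm{blkdiag}(A_1,\dots,A_p)$, $B_c=\mathrm{blkdiag}(B_1,\dots,B_p)$, $C_c=\mathrm{blkdiag}(C_1,\dots,C_p)$, be the chain-of-integrators normal form of the system under the coordinate change $x\mapsto(\eta,\xi)=(T_1(x),T_2(x))$, with initial condition $\xi_0=T_2(x_0)=(\xi_0^1,\dots,\xi_0^p)$, $\xi_0^j\in\mathbb{R}^{\gamma_j}$. Assume that for each $j\in\{1,\dots,p\}$ there exist matrices $\Pi_j\in\mathbb{R}^{\gamma_j\times m}$ and $\Gamma_j\in\mathbb{R}^{1\times m}$ satisfying $$\Pi_jS=A_j\Pi_j+B_j\Gamma_j,\qquad 0=C_j\Pi_j-H_j,$$ where $H_j$ is the $j$-th row of $H$, and put $\tilde\xi_0^j=\xi_0^j-\Pi_jw_0$. Further assume that for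 each $j$ there exists a set $\mathcal{L}_j=\{\lambda_1^j,\dots,\lambda_{\gamma_j}^j\}$ of real numbers $\lambda_1^j<\dots<\lambda_{\gamma_j}^j<0$ such that $p(\tilde\xi_0^j,\mathcal{L}_j)>0$. Let $F_j=W_jV_j^{-1}$, where $V_j\in\mathbb{R}^{\gamma_j\times\gamma_j}$ has $i$-th column $(1,\lambda_i^j,(\lambda_i^j)^2,\dots,(\lambda_i^j)^{\gamma_j-1})^T$ and $W_j=[(\lambda_1^j)^{\gamma_j}\ \cdots\ (\lambda_{\gamma_j}^j)^{\gamma_j}]$. Let $G_j=\Gamma_j-F_j\Pi_j$, $F=\mathrm{blkdiag}(F_1,\dots,F_p)$, $G=[G_1^T\ \cdots\ G_p^T]^T$ and $v=F\xi+Gw$. Then the feedback linearizing control law $$u=-A^{-1}(x)\begin{bmatrix}L_f^{\gamma_1}h_1(x)\\ \vdots\\ L_f^{\gamma_p}h_p(x)\end{bmatrix}+A^{-1}(x)v$$ yields nonovershooting output regulation from the initial condition $(x_0,w_0)$. That is, it stabilizes the closed-loop system, and the tracking error $e(t)=r(t)-y(t)$ satisfies $e(t)\to0$ as $t\to\infty$, with no component of $e$ changing sign for $t\ge0$.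
   Context: Lie derivatives: $L_f\phi=\frac{\partial\phi}{\partial x}f$, $L_f^0\phi=\phi$, $L_f^{k}\phi=L_f(L_f^{k-1}\phi)$. Here $g_i$ is the $i$-th column of $g$ and $h_i$ the $i$-th component of $h$. Relative degree: the system has relative degree vector $(\gamma_1,\dots,\gamma_p)$ at $x_0$ if (1) for every $i,l\in\{1,\dots,p\}$, $L_{g_l}L_f^kh_i(x)\equiv0$ for $0\le k\le\gamma_i-2$, and for every $i$ at least one $L_{g_l}L_f^{\gamma_i-1}h_i$ is nonzero; and (2) the $p\times p$ matrix $A(x)$ with $(i,l)$ entry $L_{g_l}L_f^{\gamma_i-1}h_i(x)$ is nonsingular at $x=x_0$. Normal form: put $\gamma=\gamma_1+\dots+\gamma_p$. Under these assumptions there is a neighbourhood $U$ of $x_0$ on which there exists a change of coordinates $x\mapsto(T_1(x),T_2(x))=(\eta,\xi)$ with $\eta=(\eta_1,\dots,\eta_{n-\gamma})$, $\frac{\partial\eta_i}{\partial x}g(x)=0$, $\xi=(\xi^1,\dots,\xi^p)$ and $\xi^j=(h_j(x),L_fh_j(x),\dots,L_f^{\gamma_j-1}h_j(x))^T$. In these coordinates, applying the control law $u=-A^{-1}(x)[L_f^{\gamma_1}h_1,\dots,L_f^{\gamma_p}h_p]^T+A^{-1}(x)v$ gives the normal form $\dot\eta=f_0(\eta,\xi)$, $\dot\xi=A_c\xi+B_cv$, $y=C_c\xi$. Each $(A_j,B_j,C_j)$ is the SISO chain of integrators of order $\gamma_j$: $A_j\in\mathbb{R}^{\gamma_j\times\gamma_j}$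 has ones on the first superdiagonal and zeros elsewhere, $B_j=(0,\dots,0,1)^T$, $C_j=(1,0,\dots,0)$. The symbol $\mathrm{blkdiag}$ denotes the block diagonal matrix with the given (possibly non-square) blocks. Stability: the zero dynamics is stable means that $\eta=0$ is an asymptotically stable equilibrium of $\dot\eta=f_0(\eta,0)$. The control law stabilizes the closed-loop system means that, with $w\equiv0$, $(\eta,\xi)=(0,0)$ is an asymptotically stable equilibrium of the closed loop. The function $p$: for $z_0\in\mathbb{R}^N$ and $\mathcal{L}=\{\lambda_1,\dots,\lambda_N\}$ with $\lambda_1<\dots<\lambda_N<0$, let $V$ be the $N\times N$ matrix with $i$-th column $(1,\lambda_i,\dots,\lambda_i^{N-1})^T$ and let $\alpha=(\alpha_1,\dots,\alpha_N)^T=V^{-1}z_0$. For $k\in\{1,\dots,N-1\}$ let $c_k=1$ if $\alpha_k\alpha_N<0$ and $c_k=0$ otherwise. Then $$p(z_0,\mathcal{L})=|\alpha_N|+(1-c_{N-1})|\alpha_{N-1}|-\sum_{k=1}^{N-1}c_k|\alpha_k|,$$ where for $N=1$ the terms with index $N-1$ and the sum are absent. (The scalar-valued function $p(\cdot,\cdot)$ is distinct from the number $p$ of inputs and outputs.)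
   Formalization: Adds: if γ_j≥3, the coefficient α_{γ_j} of ξ̃_0^j is nonzero (else p>0 does not prevent a sign change). Tracking is stated for closed-loop solutions staying in U while they exist, with e→0 if they exist for all t≥0, since finite escape from x_0 can occur. *)

(* Defs.v *)
From HB Require Import structures.
From mathcomp Require Import all_boot all_order all_algebra.
From mathcomp Require Import all_classical all_reals all_analysis.

Set Implicit Arguments.
Unset Strict Implicit.
Unset Printing Implicit Defensive.

Import Order.TTheory GRing.Theory Num.Theory.
Import numFieldNormedType.Exports.

Local Open Scope classical_set_scope.
Local Open Scope ring_scope.

Section Smooth.
Variables (R : realType) (V W : normedModType R).

(* For D open and V, W finite-dimensional, this is the class C^k on D. *)
Fixpoint Ck (k : nat) (D : set V) (phi : V -> W) : Prop :=
  if k is k'.+1 then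
    (forall x, D x -> differentiable phi x) /\
    (forall v, Ck k' D (fun x => 'd phi x v))
  else forall x, D x -> {for x, continuous phi}.

Definition smooth (D : set V) (phi : V -> W) : Prop := forall k, Ck k D phi.

End Smooth.

(* U is meant to be open; [Tinv] is a smooth inverse of T on the open set T(U). *)
Definition diffeomorphism (R : realType) (V W : normedModType R) (U : set V)
    (T : V -> W) (Tinv : W -> V) : Prop :=
  [/\ smooth U T, open (T @` U), forall x, U x -> Tinv (T x) = x &
      smooth (T @` U) Tinv].

Section DiffLinear.
Variable R : realType.

Lemma diff_linear_comp (V W Z : normedModType R) (L : {linear W -> Z})
    (F : V -> W) (x v : V) :
  continuous L -> differentiable F x -> 'd (L \o F) x v = L ('d F x v).
Proof.
move=> cL dF; rewrite diff_comp //=; last exact: linear_differentiable.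
by rewrite diff_lin.
Qed.

Lemma diff_coord (V : normedModType R) (m q : nat) (F : V -> 'M[R]_(m, q))
    (x v : V) i j :
  differentiable F x -> ('d F x v) i j = 'd (fun y => F y i j : R) x v.
Proof.
move=> dF; have lin : linear (fun N : 'M[R]_(m, q) => N i j : R).
  by move=> a A B; rewrite !mxE.
pose L : {linear 'M[R]_(m, q) -> R} :=
  HB.pack (fun N : 'M[R]_(m, q) => N i j : R) (GRing.isLinear.Build _ _ _ _ _ lin).
have Lcont : continuous L by exact: coord_continuous.
by rewrite -[LHS]/(L ('d F x v)) -(diff_linear_comp v Lcont dF).
Qed.

End DiffLinear.

Section Ode.
Variables (R : realType) (V : normedModType R).

(* z' = X(t, z) on [0, tau[, with z staying in D. The derivative at t = 0 is
   replaced by continuity, which is equivalent when X is continuous. *)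
Definition solution (D : set V) (tau : \bar R) (X : R -> V -> V) (z : R -> V) :
    Prop :=
  [/\ forall t, 0 <= t -> (t%:E < tau)%E -> D (z t),
      {within [set t | 0 <= t /\ (t%:E < tau)%E], continuous z} &
      forall t, 0 < t -> (t%:E < tau)%E -> is_derive t (1 : R) z (X t (z t))].

(* The origin is asymptotically stable for z' = X(z) on D. Solutions on every
   [0, tau[ are considered, so that finite escape is excluded, and solutions
   starting near the origin are required to exist on [0, +oo[. *)
Definition asymptotically_stable (D : set V) (X : V -> V) : Prop :=
  [/\ D 0,
      X 0 = 0,
      (forall eps : R, 0 < eps -> exists2 delta : R, 0 < delta &
         forall tau z, solution D tau (fun=> X) z -> `|z 0| < delta ->
         forall t, 0 <= t -> (t%:E < tau)%E -> `|z t| < eps) &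
      exists2 delta : R, 0 < delta &
        (forall z0, `|z0| < delta ->
           exists2 z, solution D +oo%E (fun=> X) z & z 0 = z0) /\
        (forall z, solution D +oo%E (fun=> X) z -> `|z 0| < delta ->
           z t @[t --> +oo] --> (0 : V))].

End Ode.

Definition changes_sign (R : realType) (tau : \bar R) (phi : R -> R) : Prop :=
  exists s t, [/\ 0 <= s, (s%:E < tau)%E, 0 <= t, (t%:E < tau)%E &
                  phi s * phi t < 0].

Section BlockDiagonal.
Variable R : realType.

(* Same encoding as [mxdiag], but for rectangular blocks: the [conform_mx] only
   serves to retype the blocks with i = j. *)
Definition blkdiag (p : nat) (m q : 'I_p -> nat)
    (M : forall i, 'M[R]_(m i, q i)) : 'M[R]_(\sum_i m i, \sum_i q i) :=
  \mxblock_(i, j) (if i == j then conform_mx 0 (M i) else 0).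

Lemma sum_ones (p : nat) : (\sum_(i < p) 1 = p)%N.
Proof. by rewrite sum_nat_const card_ord muln1. Qed.

(* Block diagonal matrices all of whose blocks have one column, resp. one row. *)
Definition blkdiag_col (p : nat) (m : 'I_p -> nat)
    (M : forall i, 'cV[R]_(m i)) : 'M[R]_(\sum_i m i, p) :=
  castmx (erefl, sum_ones p) (blkdiag (q := fun=> 1%N) M).

Definition blkdiag_row (p : nat) (q : 'I_p -> nat)
    (M : forall i, 'rV[R]_(q i)) : 'M[R]_(p, \sum_i q i) :=
  castmx (sum_ones p, erefl) (blkdiag (m := fun=> 1%N) M).

Lemma mul_blkdiag (p : nat) (m q : 'I_p -> nat)
    (M : forall i, 'M[R]_(m i, q i)) (r : nat) (N : forall i, 'M[R]_(q i, r)) :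
  blkdiag M *m \mxcol_i N i = \mxcol_i (M i *m N i).
Proof.
rewrite /blkdiag mul_mxblock_mxrow; apply: eq_mxcol => i.
rewrite (bigD1 i) //= eqxx conform_mx_id big1 ?addr0 // => j /negbTE ji.
by rewrite eq_sym ji mul0mx.
Qed.

Lemma cast_sum_ones (p : nat) (v : 'cV[R]_p) :
  castmx (esym (sum_ones p), erefl) v = \mxcol_(i < p) (v i 0)%:M.
Proof.
apply/matrixP => i j; rewrite castmxE !mxE.
have i2 : tagnat.sig2 i = 0 :> nat by case: (tagnat.sig2 i) => -[].
have iE : (\sum_(k < p | k < tagnat.sig1 i) 1 = tagnat.sig1 i)%N.
  by rewrite -(big_ord_widen p (fun=> 1%N)) ?sum_ones // ltnW.
rewrite [X in _ *+ X](_ : _ = 1%N); last first.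
  by rewrite -[RHS]/(true : nat);
     congr nat_of_bool; apply/eqP/val_inj; rewrite /= i2 ord1.
rewrite mulr1n; congr (v _ _); apply: val_inj => /=; last by rewrite !ord1.
by rewrite [LHS]tagnat.rect iE i2 addn0.
Qed.

Lemma mul_castmx_l (m n n' k : nat) (e : n = n') (A : 'M[R]_(m, n))
    (B : 'M[R]_(n', k)) :
  castmx (erefl, e) A *m B = A *m castmx (esym e, erefl) B.
Proof. by case: _ / e B => B; rewrite !castmx_id. Qed.

Lemma mul_castmx_r (m m' n k : nat) (e : m = m') (A : 'M[R]_(m, n))
    (B : 'M[R]_(n, k)) :
  castmx (e, erefl) A *m B = castmx (e, erefl) (A *m B).
Proof. by case: _ / e; rewrite !castmx_id. Qed.

Lemma mul_blkdiag_col (p : nat) (m : 'I_p -> nat)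
    (M : forall i, 'cV[R]_(m i)) (v : 'cV[R]_p) :
  blkdiag_col M *m v = \mxcol_i (v i 0 *: M i).
Proof.
rewrite /blkdiag_col mul_castmx_l.
rewrite cast_sum_ones mul_blkdiag; apply: eq_mxcol => i.
by rewrite mul_mx_scalar.
Qed.

Lemma mul_blkdiag_row (p : nat) (q : 'I_p -> nat)
    (M : forall i, 'rV[R]_(q i)) (N : forall i, 'cV[R]_(q i)) :
  blkdiag_row M *m \mxcol_i N i = \col_i (M i *m N i) 0 0.
Proof.
rewrite /blkdiag_row mul_castmx_r.
rewrite mul_blkdiag; apply: (canLR (castmxKV _ _)) => /=.
rewrite cast_sum_ones; apply: eq_mxcol => i.
by rewrite mxE; apply/matrixP => a b; rewrite !ord1 [RHS]mxE mulr1n.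
Qed.

End BlockDiagonal.

Section Chain.
Variables (R : realType) (N : nat).

Definition chainA : 'M[R]_N := \matrix_(i, j) (j == i.+1 :> nat)%:R.
Definition chainB : 'cV[R]_N := \col_i (i.+1 == N)%:R.
Definition chainC : 'rV[R]_N := \row_j (j == 0 :> nat)%:R.

(* A set lambda_1 < ... < lambda_N < 0 is listed as a row vector. *)
Definition negative_spectrum (lam : 'rV[R]_N) : Prop :=
  (forall i, lam 0 i < 0) /\ (forall i j : 'I_N, (i < j)%N -> lam 0 i < lam 0 j).

Definition modal_matrix (lam : 'rV[R]_N) : 'M[R]_N := Vandermonde N lam.

Definition modal_gain (lam : 'rV[R]_N) : 'rV[R]_N :=
  (\row_i lam 0 i ^+ N) *m invmx (modal_matrix lam).

(* alpha_k = (V^-1 z0)_k with the 1-based index k; it is 0 for k = 0 and for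
   k > N, so for N = 1 the terms of index N - 1 in [pfun] vanish. *)
Definition modal_coef (z0 : 'cV[R]_N) (lam : 'rV[R]_N) (k : nat) : R :=
  \sum_(i < N | i.+1 == k) (invmx (modal_matrix lam) *m z0) i 0.

Definition pfun (z0 : 'cV[R]_N) (lam : 'rV[R]_N) : R :=
  let alpha := modal_coef z0 lam in
  let c k : R := (alpha k * alpha N < 0)%R%:R in
  `|alpha N| + (1 - c N.-1) * `|alpha N.-1| - \sum_(1 <= k < N) c k * `|alpha k|.

End Chain.

Section System.
Variables (R : realType) (n p : nat).

Definition Lie (f : 'cV[R]_n -> 'cV[R]_n) (phi : 'cV[R]_n -> R) :
  'cV[R]_n -> R := fun x => 'd phi x (f x).

Definition iter_Lie (f : 'cV[R]_n -> 'cV[R]_n) (k : nat)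
    (phi : 'cV[R]_n -> R) : 'cV[R]_n -> R := iter k (Lie f) phi.

Variables (f : 'cV[R]_n -> 'cV[R]_n) (g : 'cV[R]_n -> 'M[R]_(n, p)).
Variables (h : 'cV[R]_n -> 'cV[R]_p) (gamma : 'I_p -> nat).

(* L_{g_l} L_f^k h_i *)
Definition input_Lie (i l : 'I_p) (k : nat) : 'cV[R]_n -> R :=
  Lie (fun x => col l (g x)) (iter_Lie f k (fun x => h x i 0)).

Definition decoupling_matrix (x : 'cV[R]_n) : 'M[R]_p :=
  \matrix_(i, l) input_Lie i l (gamma i).-1 x.

Definition relative_degree (x0 : 'cV[R]_n) : Prop :=
  [/\ forall i, (0 < gamma i)%N,
      \forall x \near x0, forall i l k, (k.+1 < gamma i)%N -> input_Lie i l k x = 0,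
      forall i, exists l, input_Lie i l (gamma i).-1 x0 != 0 &
      decoupling_matrix x0 \in unitmx].

Definition linearizing_control (x : 'cV[R]_n) (v : 'cV[R]_p) : 'cV[R]_p :=
  - (invmx (decoupling_matrix x)
       *m \col_i iter_Lie f (gamma i) (fun x => h x i 0) x)
  + invmx (decoupling_matrix x) *m v.

(* xi^j = (h_j, L_f h_j, ..., L_f^(gamma_j - 1) h_j) *)
Definition xi_block (j : 'I_p) (x : 'cV[R]_n) : 'cV[R]_(gamma j) :=
  \col_k iter_Lie f k (fun x => h x j 0) x.

Definition xi_coord (x : 'cV[R]_n) : 'cV[R]_(\sum_j gamma j) :=
  \mxcol_j xi_block j x.

Definition Ac : 'M[R]_(\sum_j gamma j) := blkdiag (fun j => chainA R (gamma j)).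
Definition Bc : 'M[R]_(\sum_j gamma j, p) :=
  blkdiag_col (fun j => chainB R (gamma j)).
Definition Cc : 'M[R]_(p, \sum_j gamma j) :=
  blkdiag_row (fun j => chainC R (gamma j)).

Notation deta := (n - \sum_j gamma j)%N.

Definition normal_coord (T1 : 'cV[R]_n -> 'cV[R]_deta) (x : 'cV[R]_n) :
  'cV[R]_(deta + \sum_j gamma j) := col_mx (T1 x) (xi_coord x).

(* x |-> (eta, xi) = (T1 x, xi_coord x) is a change of coordinates, with inverse
   [Tinv], on the neighbourhood U of x0, on which the relative degree conditions
   persist; f0 is the resulting drift of eta. That the linearizing control then
   yields the chain-of-integrators form is [normal_formP] below. *)
Record normal_form (x0 : 'cV[R]_n) (U : set 'cV[R]_n)
    (T1 : 'cV[R]_n -> 'cV[R]_deta)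
    (Tinv : 'cV[R]_(deta + \sum_j gamma j) -> 'cV[R]_n)
    (f0 : 'cV[R]_deta -> 'cV[R]_(\sum_j gamma j) -> 'cV[R]_deta) : Prop :=
  NormalForm {
    nf_nbhs : open_nbhs x0 U;
    nf_vanish : forall x, U x ->
      forall i l k, (k.+1 < gamma i)%N -> input_Lie i l k x = 0;
    nf_unit : forall x, U x -> decoupling_matrix x \in unitmx;
    nf_diffeo : diffeomorphism U (normal_coord T1) Tinv;
    nf_eta : forall x, U x -> forall l, 'd T1 x (col l (g x)) = 0;
    nf_drift : forall x, U x -> f0 (T1 x) (xi_coord x) = 'd T1 x (f x)
  }.

(* (f0(eta, xi), Ac xi + Bc v) at z = (eta, xi) *)
Definition normal_form_field
    (f0 : 'cV[R]_deta -> 'cV[R]_(\sum_j gamma j) -> 'cV[R]_deta)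
    (v : 'cV[R]_p) (z : 'cV[R]_(deta + \sum_j gamma j)) :
    'cV[R]_(deta + \sum_j gamma j) :=
  col_mx (f0 (usubmx z) (dsubmx z)) (Ac *m dsubmx z + Bc *m v).

Lemma normal_formP x0 U T1 Tinv f0 : normal_form x0 U T1 Tinv f0 ->
  (forall i, (0 < gamma i)%N) -> forall x, U x -> forall v,
  'd (normal_coord T1) x (f x + g x *m linearizing_control x v)
    = normal_form_field f0 v (normal_coord T1 x)
  /\ h x = Cc *m xi_coord x.
Proof.
move=> nf gamma_gt0 x Ux v; split; last first.
  rewrite /Cc mul_blkdiag_row; apply/matrixP => i j; rewrite !mxE ord1.
  rewrite (bigD1 (Ordinal (gamma_gt0 i))) //= !mxE /= mul1r big1 ?addr0 //.
  move=> k k0; rewrite !mxE (_ : _ == _ = false) ?mul0r //.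
  by apply: contra_neqF k0 => /eqP kE; apply: val_inj.
have [/(_ 1%N)[/(_ _ Ux) dT _] _ _ _] := nf_diffeo nf.
set u := linearizing_control x v; set X := f x + _.
have XE : X = f x + \sum_l u l 0 *: col l (g x).
  rewrite /X; congr (_ + _); apply/matrixP => i j.
  rewrite ord1 mxE summxE; apply: eq_bigr => l _.
  by rewrite !mxE mulrC.
have usub_cont : continuous
    (usubmx : 'cV[R]_(deta + \sum_j gamma j) -> 'cV[R]_deta).
  move=> s A /nbhs_ballP[e e0 es]; apply/nbhs_ballP; exists e => // N [_ MN].
  by apply: es; split => // i j; rewrite !mxE; exact: MN.
rewrite /normal_form_field /normal_coord col_mxKu col_mxKd.
rewrite -[LHS]vsubmxK; congr col_mx.
  rewrite -(diff_linear_comp X usub_cont dT).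
  rewrite (_ : _ \o _ = T1); last first.
    by apply/funext => y; rewrite /= /normal_coord col_mxKu.
  rewrite (nf_drift nf Ux) XE linearD linear_sum.
  rewrite [X in _ + X]big1 ?addr0 // => l _.
  by rewrite linearZ /= (nf_eta nf Ux) scaler0.
rewrite /Ac /Bc mul_blkdiag mul_blkdiag_col -mxcolD.
rewrite -[LHS]submxcolK; apply: eq_mxcol => j; apply/matrixP => k o.
rewrite ord1 !mxE {o}.
set phi := iter_Lie f k (fun y => h y j 0).
have -> : ('d (normal_coord T1) x X) (rshift deta (tagnat.Rank j k)) 0 =
          'd phi x X.
  rewrite diff_coord //; congr ('d _ x X); apply/funext => y.
  rewrite /normal_coord col_mxEd /xi_coord.
  by have /matrixP/(_ k 0) := mxcolK (xi_block ^~ y) j; rewrite !mxE.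
have -> : 'd phi x X = iter_Lie f k.+1 (fun y => h y j 0) x
                       + \sum_l u l 0 * input_Lie j l k x.
  rewrite XE linearD linear_sum; congr (_ + _); apply: eq_bigr => l _.
  by rewrite linearZ.
have [kl|kl] := ltnP k.+1 (gamma j).
  rewrite big1 ?addr0; last by move=> l _; rewrite (nf_vanish nf Ux) ?mulr0.
  rewrite ltn_eqF // mulr0 addr0 (bigD1 (Ordinal kl)) //= !mxE eqxx mul1r.
  rewrite big1 ?addr0 // => l lk; rewrite !mxE (_ : _ == _ = false) ?mul0r //.
  by apply: contra_neqF lk => /eqP lE; apply: val_inj.
have kE : k.+1 = gamma j by apply/eqP; rewrite eqn_leq kl ltn_ord.
rewrite kE eqxx mulr1 [in RHS]big1 ?add0r; last first.
  move=> l _; rewrite !mxE (_ : _ == _ = false) ?mul0r //.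
  by rewrite ltn_eqF // kE ltn_ord.
have uE : decoupling_matrix x *m u =
    - (\col_i iter_Lie f (gamma i) (fun x => h x i 0) x) + v.
  rewrite /u /linearizing_control mulmxDr mulmxN !mulmxA.
  by rewrite mulmxV ?mul1mx //; exact: (nf_unit nf Ux).
have -> : \sum_l u l 0 * input_Lie j l k x = (decoupling_matrix x *m u) j 0.
  rewrite [RHS]mxE; apply: eq_bigr => l _; rewrite [in RHS]mxE mulrC.
  by rewrite (congr1 predn (esym kE)).
by rewrite uE !mxE addrA subrr add0r.
Qed.

End System.

(* Main.v *)
(* In the normal form the loop splits into chains of integrators and the internal
   dynamics. For each output, zeta = xi^j - Pi_j w solves zeta' = (A_j + B_j F_j) zeta,
   and the Vandermonde matrix diagonalizes A_j + B_j F_j; hence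
   e_j(t) = - sum_k alpha_k exp(lambda_k t) with alpha = V_j^-1 (xi_0^j - Pi_j w_0).
   The condition p > 0 says that the slowest modes of one sign dominate all modes
   of the opposite sign, so this sum never changes sign.

   Stability is that of a cascade driven by an exponentially decaying xi, obtained
   without a converse Lyapunov theorem. By compactness the zero dynamics contracts
   a small ball into a smaller one in a uniform time T, and by Gronwall's inequality
   a small input xi does not spoil this on a window of length T; one then iterates
   over windows. Solutions exist by Picard iteration on a truncated field. *)

Require Import Defs.
From HB Require Import structures.
From mathcomp Require Import all_boot all_order all_algebra.
From mathcomp Require Import all_classical all_reals all_analysis.
From mathcomp Require Import ring lra.

Set Implicit Arguments.
Unset Strict Implicit.
Unset Printing Implicit Defensive.

Import Order.TTheory GRing.Theory Num.Theory.
Import numFieldNormedType.Exports.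

Local Open Scope classical_set_scope.
Local Open Scope ring_scope.

(** * Scalar differential inequalities *)

(** Three obstacles shape the argument. The max norm is nonsmooth and vector functions have no mean
    value equality, so estimates are made on coordinates and reduced to the scalar mean value
    theorem. The drift [f0] is constrained only through its values on the image of [U], and its
    Lipschitz bound is available only in a box around the origin. A trajectory must thus be shown to
    stay in the box by the very estimate that presupposes it; a first-exit argument breaks this
    circle, and for existence the field is clamped outside the box. Finally, attraction in the
    definition of stability is pointwise and has no rate. It becomes locally uniform because one
    close approach to the origin is enough: from then on stability alone keeps a trajectory small.
    The comparison trajectories of the zero dynamics come from the existence clause of
    [asymptotically_stable]. Tracking is independent of these estimates: the error formula is exact
    on whatever interval a solution in [U] exists. *)

Section Antiderivative.
Variable R : realType.
Implicit Types (a b c d k t : R) (x y z : R -> R).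

(** Derivative inside, continuity relative to the interval at its ends: this is what [solution]
    provides at time 0, and just what the mean value theorem consumes. *)
Definition antider a b y y' : Prop :=
  (forall t, a <= t <= b -> y s @[s --> within `[a, b] (nbhs t)] --> y t) /\
  (forall t, a < t < b -> is_derive t (1 : R) y (y' t)).

Lemma antiderW a b c d y y' : a <= c -> d <= b ->
  antider a b y y' -> antider c d y y'.
Proof.
move=> ac db [yc yd]; split=> t /andP[ct td]; last first.
  by apply: yd; rewrite (le_lt_trans ac) ?(lt_le_trans td).
have tab : a <= t <= b by rewrite (le_trans ac) ?(le_trans td).
apply: cvg_trans (yc t tab).
apply: cvg_app => P; rewrite !nbhs_simpl /within/=; apply: filterS => s sP; rewrite in_itv/= => /andP[cs sd].
by apply: sP; rewrite in_itv/= (le_trans ac) ?(le_trans sd).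
Qed.

Lemma eq_antider a b y y' z' : (forall t, a < t < b -> y' t = z' t) ->
  antider a b y y' -> antider a b y z'.
Proof.
by move=> e [yc yd]; split=> // t tab; rewrite -e //; exact: yd.
Qed.

Lemma antider_total a b y y' : (forall t, a <= t <= b -> {for t, continuous y}) ->
  (forall t, a < t < b -> is_derive t (1 : R) y (y' t)) -> antider a b y y'.
Proof.
move=> yc yd; split=> // t tab; apply: cvg_trans (yc t tab).
by apply: cvg_app; exact: cvg_within.
Qed.

Lemma antider_derive a b y y' :
  (forall t, is_derive t (1 : R) y (y' t)) -> antider a b y y'.
Proof.
move=> yd; apply: antider_total => // t _.
by apply: differentiable_continuous; apply/derivable1_diffP; case: (yd t).
Qed.

Lemma antiderD a b y y' z z' : antider a b y y' -> antider a b z z' ->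
  antider a b (fun t => y t + z t) (fun t => y' t + z' t).
Proof.
move=> [yc yd] [zc zd]; split=> t tab; first by apply: cvgD; auto.
by apply: is_deriveD; auto.
Qed.

Lemma antiderM a b y y' z z' : antider a b y y' -> antider a b z z' ->
  antider a b (fun t => y t * z t) (fun t => y' t * z t + y t * z' t).
Proof.
move=> [yc yd] [zc zd]; split=> t tab; first by apply: cvgM; auto.
have := is_deriveM (yd _ tab) (zd _ tab); move=> dH; apply: (is_derive_eq dH).
by rewrite addrC /GRing.scale/= [y' t * _]mulrC.
Qed.

Lemma antider_cst a b k : antider a b (fun=> k) (fun=> 0).
Proof. by apply: antider_derive => t; exact: is_derive_cst. Qed.

Lemma antiderZ a b k y y' : antider a b y y' ->
  antider a b (fun t => k * y t) (fun t => k * y' t).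
Proof.
move=> /(antiderM (antider_cst a b k)); apply: eq_antider => t _.
by rewrite mul0r add0r.
Qed.

Lemma antiderN a b y y' : antider a b y y' ->
  antider a b (fun t => - y t) (fun t => - y' t).
Proof.
move=> [yc yd]; split=> t tab; first by apply: cvgN; auto.
by apply: is_deriveN; auto.
Qed.

Lemma antiderB a b y y' z z' : antider a b y y' -> antider a b z z' ->
  antider a b (fun t => y t - z t) (fun t => y' t - z' t).
Proof. by move=> yy /antiderN; exact: antiderD. Qed.

Lemma antider_sum a b (I : Type) (r : seq I) (y y' : I -> R -> R) :
  (forall i, antider a b (y i) (y' i)) ->
  antider a b (fun t => \sum_(i <- r) y i t) (fun t => \sum_(i <- r) y' i t).
Proof.
move=> yy; elim: r => [|i r IH].
  under [X in antider _ _ X]eq_fun do rewrite big_nil.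
  by under [X in antider _ _ _ X]eq_fun do rewrite big_nil; exact: antider_cst.
under [X in antider _ _ X]eq_fun do rewrite big_cons.
by under [X in antider _ _ _ X]eq_fun do rewrite big_cons; exact: antiderD.
Qed.

Lemma antider_id a b : antider a b id (fun=> 1).
Proof. by apply: antider_derive => t; exact: is_derive_id. Qed.

Lemma antider_expR a b k :
  antider a b (fun t => expR (k * t)) (fun t => k * expR (k * t)).
Proof.
apply: antider_derive => t.
have kd : is_derive t (1 : R) ( *%R k) k.
  have := is_deriveZ k (is_derive_id t (1 : R)).
  by move=> dH; apply: (is_derive_eq dH); rewrite /GRing.scale/= mulr1.
by have := is_derive1_comp (is_derive_expR (k * t)) kd; rewrite mulrC.
Qed.

Lemma antider_shift a b c y y' : antider (a + c) (b + c) y y' ->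
  antider a b (fun t => y (t + c)) (fun t => y' (t + c)).
Proof.
move=> [yc yd]; split=> t /andP[at_ tb]; last first.
  have tc : a + c < t + c < b + c by rewrite !ltrD2r at_ tb.
  have := @is_derive1_comp R y (shift c) t _ _ (yd _ tc) (is_derive_shift t 1 c).
  by move=> dH; apply: (is_derive_eq dH); rewrite mulr1.
have tc : a + c <= t + c <= b + c by rewrite !lerD2r at_ tb.
apply: cvg_comp (yc _ tc) => A /=.
rewrite !nbhs_simpl /= /within/= => -[e e0 eA].
exists e => //= s st; rewrite in_itv/= => /andP[as_ sb].
apply: eA; last by rewrite in_itv/= !lerD2r as_.
by move: st; rewrite /ball_/= opprD addrACA subrr addr0.
Qed.

Lemma antider_within a b y y' : antider a b y y' ->
  {within `[a, b], continuous y}.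
Proof. by move=> [yc _]; apply/subspace_continuousP => t; exact: yc. Qed.

Lemma antider_MVT a b y y' : a < b -> antider a b y y' ->
  exists2 c, a < c < b & y b - y a = y' c * (b - a).
Proof.
move=> ab yy.
have yd t : t \in `]a, b[ -> is_derive t (1 : R) y (y' t).
  by rewrite in_itv/=; exact: yy.2.
by have [c] := MVT ab yd (antider_within yy); rewrite in_itv; exists c.
Qed.

(** The mean value theorem for [z - y] replaces integration, so no integrability of the derivatives
    has to be established. *)
Lemma antider_le a b y y' z z' : a <= b -> antider a b y y' ->
  antider a b z z' -> y a <= z a -> (forall t, a < t < b -> y' t <= z' t) ->
  y b <= z b.
Proof.
move=> + yy zz yza yzt; rewrite le_eqVlt => /predU1P[<- //|ab].
have [c cab e] := antider_MVT ab (antiderB zz yy).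
have : 0 <= (z' c - y' c) * (b - a).
  by rewrite mulr_ge0 // subr_ge0 ?(ltW ab) // yzt.
by rewrite -e; lra.
Qed.

(** Compares [y t] times exp(-k (t - a)), whose derivative is at most [c], with [y a + c * (t - a)].
    Bounding the weight by 1 in front of [c] gives a cruder constant but avoids dividing by [k]. *)
Lemma antider_gronwall a b y y' k c : a <= b -> 0 <= k -> 0 <= c ->
  antider a b y y' -> (forall t, a < t < b -> y' t <= k * y t + c) ->
  y b <= (y a + c * (b - a)) * expR (k * (b - a)).
Proof.
move=> ab k0 c0 yy yle.
have ex : antider a b (fun t => expR (- k * (t + - a)))
                     (fun t => - k * expR (- k * (t + - a))).
  by apply: (@antider_shift a b (- a) (fun t => expR (- k * t))
    (fun t => - k * expR (- k * t))); exact: antider_expR.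
have {ex}/= := antider_le ab (antiderM yy ex) (antiderD (antider_cst a b (y a))
  (antiderZ c (antiderB (antider_id a b) (antider_cst a b a)))).
rewrite subrr mulr0 expR0 mulr1 mulr0 addr0 => /(_ (lexx _)) H.
have H2 : y b * expR (- k * (b - a)) <= y a + c * (b - a).
  apply: H.
  move=> t tab.
  have e1 : expR (- k * (t - a)) <= 1.
    rewrite -expR0 ler_expR mulNr oppr_le0 mulr_ge0 // subr_ge0 ltW //.
    by case/andP: tab.
  have := yle t tab; have := expR_ge0 (- k * (t - a)).
  set E := expR _ in e1 *; move=> E0 H.
  have h1 : E * (y' t - k * y t) <= E * c.
    by rewrite ler_wpM2l // lerBlDl.
  have h2 : E * c <= c by rewrite ler_piMl.
  by rewrite /=; lra.
by move: H2; rewrite mulNr expRN ler_pdivrMr ?expR_gt0 //.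
Qed.
End Antiderivative.

(** * Vector-valued functions *)

Section VectorAntiderivative.
Variable R : realType.
Implicit Types (a b c e k t : R).

Lemma mx_norm_coord m n (x : 'M[R]_(m, n)) i j : `|x i j| <= `|x|.
Proof. by rewrite [leRHS]/Num.Def.normr/= mx_normrE; exact: (le_bigmax _ _ (i, j)). Qed.

Lemma mx_norm_le m n (x : 'M[R]_(m, n)) e : 0 <= e ->
  (forall i j, `|x i j| <= e) -> `|x| <= e.
Proof.
by move=> e0 xe; rewrite [leLHS]/Num.Def.normr/= mx_normrE; apply: bigmax_le.
Qed.

Lemma cv_norm_le n (x : 'cV[R]_n) e : 0 <= e ->
  (forall i, `|x i 0| <= e) -> `|x| <= e.
Proof. by move=> e0 xe; apply: mx_norm_le => // i j; rewrite ord1. Qed.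

Lemma cv_norm_sqr n (x : 'cV[R]_n) : `|x| ^+ 2 <= \sum_i x i 0 ^+ 2.
Proof.
have s0 : 0 <= \sum_i x i 0 ^+ 2 by apply: sumr_ge0 => i _; exact: sqr_ge0.
rewrite -[leRHS]sqr_sqrtr // lerXn2r ?nnegrE ?sqrtr_ge0 //.
apply: cv_norm_le => [|i]; first exact: sqrtr_ge0.
rewrite -sqrtr_sqr ler_wsqrtr // (bigD1 i) //= lerDl.
by apply: sumr_ge0 => j _; exact: sqr_ge0.
Qed.

Lemma mulmx_norm_le m n p (A : 'M[R]_(m, n)) (B : 'M[R]_(n, p)) :
  `|A *m B| <= n%:R * `|A| * `|B|.
Proof.
apply: mx_norm_le => [|i j]; first by rewrite !mulr_ge0.
rewrite mxE (le_trans (ler_norm_sum _ _ _)) //.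
rewrite (@le_trans _ _ (\sum_(k < n) `|A| * `|B|)) //.
  by apply: ler_sum => k _; rewrite normrM ler_pM // mx_norm_coord.
by rewrite sumr_const card_ord mulr_natl mulrnAl.
Qed.

Lemma col_mx_norm_le m n (x : 'cV[R]_m) (y : 'cV[R]_n) e :
  `|x| <= e -> `|y| <= e -> `|col_mx x y| <= e.
Proof.
move=> xe ye; apply: cv_norm_le => [|i]; first exact: le_trans xe.
rewrite mxE; case: (fintype.split i) => j.
  exact: le_trans (mx_norm_coord _ _ _) xe.
exact: le_trans (mx_norm_coord _ _ _) ye.
Qed.

Lemma usubmx_norm_le m n (z : 'cV[R]_(m + n)) : `|usubmx z| <= `|z|.
Proof. by apply: cv_norm_le => // i; rewrite mxE mx_norm_coord. Qed.

Lemma dsubmx_norm_le m n (z : 'cV[R]_(m + n)) : `|dsubmx z| <= `|z|.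
Proof. by apply: cv_norm_le => // i; rewrite mxE mx_norm_coord. Qed.

(** Stated per coordinate because the mean value theorem holds for scalar functions only. *)
Definition vantider n a b (z z' : R -> 'cV[R]_n) : Prop :=
  forall i, antider a b (fun t => z t i 0) (fun t => z' t i 0).

Lemma vantiderW n a b c d (z z' : R -> 'cV[R]_n) : a <= c -> d <= b ->
  vantider a b z z' -> vantider c d z z'.
Proof. by move=> ac db zz i; apply: antiderW (zz i). Qed.

Lemma eq_vantider n a b (z y' z' : R -> 'cV[R]_n) :
  (forall t, a < t < b -> y' t = z' t) -> vantider a b z y' -> vantider a b z z'.
Proof. by move=> e zz i; apply: eq_antider (zz i) => t /e ->. Qed.

Lemma vantiderB n a b (y y' z z' : R -> 'cV[R]_n) : vantider a b y y' ->
  vantider a b z z' -> vantider a b (fun t => y t - z t) (fun t => y' t - z' t).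
Proof.
move=> yy zz i; under [X in antider _ _ X]eq_fun do rewrite !mxE.
by under [X in antider _ _ _ X]eq_fun do rewrite !mxE; exact: antiderB.
Qed.

Lemma vantiderM m n a b (A : 'M[R]_(m, n)) (z z' : R -> 'cV[R]_n) :
  vantider a b z z' -> vantider a b (fun t => A *m z t) (fun t => A *m z' t).
Proof.
move=> zz i; under [X in antider _ _ X]eq_fun do rewrite !mxE.
under [X in antider _ _ _ X]eq_fun do rewrite !mxE.
by apply: antider_sum => j; exact: antiderZ.
Qed.

Lemma vantider_shift n a b c (z z' : R -> 'cV[R]_n) :
  vantider (a + c) (b + c) z z' ->
  vantider a b (fun t => z (t + c)) (fun t => z' (t + c)).
Proof.
move=> zz i; exact: (@antider_shift R a b c (fun t => z t i 0) (fun t => z' t i 0)).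
Qed.

(** Each coordinate and its opposite are compared with [y], which bounds the max norm without
    differentiating it. *)
Lemma vantider_norm_le n a b (z z' : R -> 'cV[R]_n) (y y' : R -> R) :
  a <= b -> vantider a b z z' -> antider a b y y' -> `|z a| <= y a ->
  (forall t, a < t < b -> `|z' t| <= y' t) -> `|z b| <= y b.
Proof.
move=> ab zz yy zya zyt; apply: cv_norm_le => [|i].
  apply: (antider_le ab (antider_cst a b 0) yy) => [|t tab].
    exact: le_trans zya.
  exact: le_trans (zyt t tab).
have zia : `|z a i 0| <= y a by exact: le_trans (mx_norm_coord _ _ _) zya.
have zit t : a < t < b -> `|z' t i 0| <= y' t.
  by move=> tab; exact: le_trans (mx_norm_coord _ _ _) (zyt t tab).
rewrite ler_norml lerNl; apply/andP; split.
  apply: (antider_le ab (antiderN (zz i)) yy) => [|t /zit].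
    by move: zia; rewrite ler_norml lerNl => /andP[].
  by rewrite ler_norml lerNl => /andP[].
apply: (antider_le ab (zz i) yy) => [|t /zit].
  by move: zia; rewrite ler_norml => /andP[].
by rewrite ler_norml => /andP[].
Qed.

(* Differentiates the squared Euclidean norm, the max norm being nonsmooth. *)
Lemma vantider_gronwall n a b k c (z z' : R -> 'cV[R]_n) :
  a <= b -> 0 <= k -> 0 <= c -> vantider a b z z' ->
  (forall t, a < t < b -> `|z' t| <= k * `|z t| + c) ->
  `|z b| ^+ 2 <= n%:R * (`|z a| ^+ 2 + c ^+ 2 * (b - a))
                 * expR (n%:R * (2 * k + 1) * (b - a)).
Proof.
move=> ab k0 c0 zz zt; apply: (le_trans (cv_norm_sqr _)).
have sz : antider a b (fun t => \sum_i z t i 0 ^+ 2)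
    (fun t => \sum_i (z' t i 0 * z t i 0 + z t i 0 * z' t i 0)).
  by apply: antider_sum => i; exact: antiderM.
(* Each of the [n] summands is at most 2 |z| (k |z| + c), and 2 |z| c <= |z|^2 + c^2 yields the rate
   2 k + 1 and the forcing c^2. *)
apply: (le_trans (antider_gronwall (k := n%:R * (2 * k + 1))
                                   (c := n%:R * c ^+ 2) ab _ _ sz _)).
- by rewrite mulr_ge0 //; lra.
- by rewrite mulr_ge0 // sqr_ge0.
- move=> t tab.
  rewrite -mulrA -mulrDr mulr_natl.
  set q := \sum_i z t i 0 ^+ 2.
  rewrite (@le_trans _ _ (\sum_(i < n) ((2 * k + 1) * q + c ^+ 2))) //; last first.
    by rewrite sumr_const card_ord.
  apply: ler_sum => i _.
  have hq : `|z t| ^+ 2 <= q by exact: cv_norm_sqr.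
  have h : z t i 0 * z' t i 0 <= `|z t| * (k * `|z t| + c).
    rewrite (le_trans (ler_norm _)) // normrM ler_pM ?mx_norm_coord //.
    exact: le_trans (mx_norm_coord _ _ _) (zt t tab).
  have h2 : 2 * `|z t| * c <= `|z t| ^+ 2 + c ^+ 2.
    by have := sqr_ge0 (`|z t| - c); lra.
  have h3 : 0 <= (2 * k + 1) * (q - `|z t| ^+ 2).
    by rewrite mulr_ge0 //; lra.
  by lra.
rewrite ler_wpM2r ?expR_ge0 // [leRHS]mulrDr [n%:R * (_ * (b - a))]mulrA lerD2r.
rewrite (@le_trans _ _ (\sum_(i < n) `|z a| ^+ 2)) //; last first.
  by rewrite sumr_const card_ord mulr_natl.
apply: ler_sum => i _; rewrite -[leLHS]real_normK ?num_real // lerXn2r ?nnegrE //.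
exact: mx_norm_coord.
Qed.

(** Here [d] depends on the length bound [T] but not on the position of the window, which is what
    allows windows to be chained. *)
Lemma vantider_small n k T e : 0 <= k -> 0 <= T -> 0 < e ->
  exists2 d : R, 0 < d & forall a b c (z z' : R -> 'cV[R]_n),
    a <= b <= a + T -> vantider a b z z' -> `|z a| <= d -> 0 <= c <= d ->
    (forall t, a < t < b -> `|z' t| <= k * `|z t| + c) -> `|z b| < e.
Proof.
move=> k0 T0 e0; pose E := expR (n%:R * (2 * k + 1) * T).
have E0 : 0 < E by exact: expR_gt0.
(* The added 1 gives [M - 1 < M <= M ^+ 2], so dividing [e] by [M] also absorbs the constant of the
   squared estimate. *)
pose M := n%:R * (1 + T) * E + 1.
have M1 : 1 <= M by rewrite lerDr !mulr_ge0 // ?addr_ge0 // ltW.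
have M0 : 0 < M by exact: lt_le_trans M1.
exists (e / M) => [|a b c z z' /andP[ab bT] zz za /andP[c0 ce] zt].
  exact: divr_gt0.
have d0 : 0 <= e / M by rewrite divr_ge0 ?ltW.
rewrite -(@ltr_pXn2r _ 2) ?nnegrE //; last exact: ltW.
apply: (le_lt_trans (vantider_gronwall ab k0 c0 zz zt)).
apply: (@le_lt_trans _ _ ((e / M) ^+ 2 * (n%:R * (1 + T) * E))).
  rewrite mulrA ler_pM ?expR_ge0 //.
  - by rewrite mulr_ge0 // addr_ge0 ?sqr_ge0 // mulr_ge0 ?sqr_ge0 // subr_ge0.
  - rewrite [leRHS]mulrCA ler_wpM2l // [leRHS]mulrDr mulr1 lerD //.
      by rewrite lerXn2r // nnegrE.
    rewrite ler_pM ?sqr_ge0 ?subr_ge0 //; last by rewrite lerBlDl.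
    by rewrite lerXn2r // nnegrE.
  - rewrite ler_expR ler_wpM2l //; last by rewrite lerBlDl.
    by rewrite mulr_ge0 // addr_ge0 // mulr_ge0.
have -> : n%:R * (1 + T) * E = M - 1 by rewrite /M addrK.
rewrite expr_div_n mulrAC ltr_pdivrMr ?exprn_gt0 // ltr_pM2l ?exprn_gt0 //.
by rewrite (@lt_le_trans _ _ M) ?gtrBl // expr2 ler_peMr // ltW.
Qed.

Lemma vantider_cont n a b (z z' : R -> 'cV[R]_n) : vantider a b z z' ->
  forall t e, a <= t <= b -> 0 < e -> exists2 d : R, 0 < d &
    forall s, a <= s <= b -> `|s - t| < d -> `|z s - z t| < e.
Proof.
move=> zz t e tab e0.
have : \forall s \near t, forall i, `[a, b]%classic s -> `|z t i 0 - z s i 0| < e / 2.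
  apply: (@filter_forall _ _ (fun i s => `[a, b]%classic s -> `|z t i 0 - z s i 0| < e / 2) (nbhs t)) => i.
  have e20 : 0 < e / 2 by lra.
  have [/(_ t tab) /cvgrPdist_lt/(_ (e / 2) e20) + _] := zz i.
  by rewrite near_withinE.
move=> /nbhs_ballP[d /= d0 H]; exists d => // s sab st.
apply: (@le_lt_trans _ _ (e / 2)); last by lra.
apply: cv_norm_le => [|i]; first lra.
rewrite !mxE distrC ltW // H //=.
by rewrite /ball/= distrC.
Qed.

(** At the first time [s] at which the norm reaches [e], all earlier values lie below [e] and
    continuity gives equality at [s]. The premise of the bootstrap hypothesis therefore holds at
    [s], and its strict conclusion is absurd. *)
Lemma first_exit n a b e (z z' : R -> 'cV[R]_n) :
  vantider a b z z' -> `|z a| < e ->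
  (forall s, a <= s <= b -> (forall t, a <= t <= s -> `|z t| <= e) -> `|z s| < e) ->
  forall s, a <= s <= b -> `|z s| < e.
Proof.
move=> /vantider_cont zc za H s0 s0ab; rewrite ltNge; apply/negP => s0e.
pose B := [set t | a <= t <= b /\ e <= `|z t|].
have Bs0 : B s0 by [].
have Blb : has_lbound B by exists a => t [/andP[]].
have Binf : has_inf B by split => //; exists s0.
set s := inf B.
have sle t : B t -> s <= t by move=> Bt; exact: ge_inf.
have as_ : a <= s by apply: lb_le_inf => [|t [/andP[]] //]; exists s0.
have sb : s <= b by rewrite (le_trans (sle _ Bs0)) //; case/andP: s0ab.
have sab : a <= s <= b by rewrite as_.
have lts t : a <= t < s -> `|z t| < e.
  move=> /andP[at_ ts]; rewrite ltNge; apply/negP => zte.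
  by have := ts; rewrite ltNge sle //; split; rewrite // at_ (le_trans (ltW ts)).
have zse : e <= `|z s|.
  rewrite leNgt; apply/negP => zse.
  have [|d d0 zd] := zc s (e - `|z s|) sab; first by rewrite subr_gt0.
  have [t Bt tsd] := inf_adherent d0 Binf.
  have st := sle _ Bt; case: Bt => tab; apply/negP; rewrite -ltNge.
  have /(zd _ tab) : `|t - s| < d by rewrite ger0_norm ?subr_ge0 // ltrBlDl.
  by have := lerB_dist (z t) (z s); lra.
have sa : a < s.
  by rewrite lt_neqAle as_ andbT; apply: contraTneq za => ->; rewrite -leNgt.
(* Otherwise a point slightly to the left of [s], kept in the interval by the maximum with [a],
   would already exceed [e]. *)
have : `|z s| <= e.
  rewrite leNgt; apply/negP => zse'.
  have [|d d0 zd] := zc s (`|z s| - e) sab; first by rewrite subr_gt0.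
  pose t := Num.max a (s - d / 2).
  have ts : t < s by rewrite gt_max sa gtrBl divr_gt0.
  have at_ : a <= t by rewrite le_max lexx.
  have std : `|t - s| < d.
    rewrite distrC gtr0_norm ?subr_gt0 //.
    have : s - d / 2 <= t by rewrite le_max lexx orbT.
    by lra.
  have tab : a <= t <= b by rewrite at_ (le_trans (ltW ts)).
  have := zd t tab std; have := lts t; rewrite at_ ts => /(_ isT).
  by have := lerB_dist (z s) (z t); rewrite [`|z s - _|]distrC; lra.
move=> zs; suff : `|z s| < e by rewrite ltNge zse.
apply: H => // t /andP[at_]; rewrite le_eqVlt => /predU1P[->//|ts].
by rewrite ltW // lts // at_.
Qed.
End VectorAntiderivative.

(** * Picard iteration *)

Section Picard.
Variable R : realType.
Notation mu := (@lebesgue_measure R).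

Lemma cv_continuous n (u : R -> 'cV[R]_n) (t : R) :
  (forall i, {for t, continuous (fun s => u s i 0)}) -> {for t, continuous u}.
Proof.
move=> uc; apply/cvgrPdist_le => e e0.
have : \forall s \near t, forall i, `|u t i 0 - u s i 0| <= e.
  apply: (@filter_forall _ _ (fun i s => `|u t i 0 - u s i 0| <= e) (nbhs t)) => i.
  by have /cvgrPdist_le/(_ _ e0) := uc i.
apply: filterS => s H; apply: cv_norm_le => [|i]; first exact: ltW.
by rewrite !mxE.
Qed.

Lemma continuous_coord n (u : R -> 'cV[R]_n) i :
  continuous u -> continuous (fun t => u t i 0).
Proof.
move=> uc t.
by apply: (@continuous_comp _ _ _ u (fun x : 'cV[R]_n => x i 0)); [exact: uc|exact: coord_continuous].
Qed.

(** Integrating from -1 keeps 0 interior, so the antiderivative has a two-sided derivative at 0 and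
    is continuous there. *)
Lemma exists_antiderivative (u : R -> R) (y0 : R) : continuous u ->
  exists2 y : R -> R, y 0 = y0 &
    forall t : R, -1 < t -> is_derive t (1 : R) y (u t).
Proof.
move=> uc; pose F (x : R) : R := (\int[mu]_(t in [set` `[(-1 : R), x]]) u t)%R.
exists (fun t => F t - F 0 + y0) => [|t t1]; first by rewrite subrr add0r.
have [||||dF F'] := @continuous_FTC1_closed R u (-1) t (t + 1).
- by rewrite ltrDl.
- apply: continuous_compact_integrable; first exact: segment_compact.
  by apply: continuous_subspaceT => x; exact: uc.
- exact: t1.
- exact: uc.
have dF' : is_derive t (1 : R) F (u t).
  by apply: DeriveDef; [exact: dF|rewrite -derive1E; exact: F'].
have := is_deriveD dF' (is_derive_cst (- F 0 + y0) t (1 : R)).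
rewrite addr0; congr is_derive.
by apply/funext => s; rewrite /GRing.add/= addrA.
Qed.

(** The even extension of [z] from nonnegative times is continuous on the whole line, as is required
    of the next integrand in the Picard iteration. *)
Lemma exists_vantider n (u : R -> 'cV[R]_n) (z0 : 'cV[R]_n) : continuous u ->
  exists z : R -> 'cV[R]_n, [/\ z 0 = z0, continuous (fun t : R => z `|t|) &
    forall b, vantider 0 b z u].
Proof.
move=> uc.
have /choice[y yP] : forall i : 'I_n, exists y : R -> R, y 0 = z0 i 0 /\
    forall t : R, -1 < t -> is_derive t (1 : R) y (u t i 0).
  move=> i; have [y y0 yd] := exists_antiderivative (z0 i 0) (@continuous_coord _ u i uc).
  by exists y.
have yc i (t : R) : -1 < t -> {for t, continuous (y i)}.
  move=> t1; apply: differentiable_continuous; apply/derivable1_diffP.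
  by have [_ /(_ t t1)[]] := yP i.
exists (fun t => \col_i y i t); split.
- by apply/matrixP => i j; rewrite ord1 mxE; case: (yP i).
- move=> t; apply: cv_continuous => i.
  rewrite (_ : (fun s => _) = (fun s => y i `|s|)); last by apply/funext => s; rewrite mxE.
  apply: (@continuous_comp _ _ _ (@Num.norm R R) (y i)); first exact: norm_continuous.
  by apply: yc; rewrite (lt_le_trans _ (normr_ge0 t)) // ltrN10.
- move=> b i; rewrite (_ : (fun s => _) = y i); last by apply/funext => s; rewrite mxE.
  apply: antider_total => t /andP[t0 _].
    by apply: yc; rewrite (lt_le_trans _ t0) // ltrN10.
  by have [_] := yP i; apply; rewrite (lt_trans _ t0) // ltrN10.
Qed.

Lemma half_expn_small (C e : R) : 0 < e -> exists k : nat, C * 2^-1 ^+ k < e.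
Proof.
move=> e0; have h : `|2^-1 : R| < 1 by rewrite ger0_norm // invf_lt1 // ltr1n.
have /cvgrPdist_lt/(_ e e0) : C * 2^-1 ^+ k @[k --> \oo] --> C * 0.
  by apply: cvgMr; exact: cvg_expr.
move=> /filter_ex[k]; rewrite mulr0 sub0r normrN => Ck; exists k.
exact: le_lt_trans (ler_norm _) Ck.
Qed.

(** The weight exp(2 L t) makes the integral operator a contraction of ratio 1/2 on all of [0, +oo[
    at once, so no local solutions have to be glued. *)
Lemma picard_lindelof n (X : 'cV[R]_n -> 'cV[R]_n) (L : R) (z0 : 'cV[R]_n) :
  (forall x y, `|X x - X y| <= L * `|x - y|) ->
  exists2 z : R -> 'cV[R]_n, z 0 = z0 & forall b, vantider 0 b z (fun t => X (z t)).
Proof.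
(* Then [L] can be divided by, and the derivative 2 L M exp(2 L t) of the first bound [w 0]
   dominates [M]. *)
wlog L1 : L / 1 <= L.
  move=> H XL; apply: (H (Num.max 1 L)); first by rewrite le_max lexx.
  move=> x y; rewrite (le_trans (XL x y)) // ler_wpM2r //.
  by rewrite le_max lexx orbT.
move=> XL; have L0 : 0 < L by exact: lt_le_trans L1.
have Xc (u : R -> 'cV[R]_n) : continuous u -> continuous (fun t => X (u t)).
  move=> uc t; apply/cvgrPdist_lt => e e0.
  have := uc t => /cvgrPdist_lt/(_ (e / L) (divr_gt0 e0 L0)).
  apply: filterS => s; rewrite ltr_pdivlMr // mulrC.
  exact: le_lt_trans (XL _ _).
(* [J] is the Picard operator, made total by choice; its value at a discontinuous [u] is
   arbitrary. *)
have /choice[J JP] : forall u : R -> 'cV[R]_n, exists z : R -> 'cV[R]_n,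
    continuous u -> [/\ z 0 = z0, continuous (fun t : R => z `|t|) &
    forall b, vantider 0 b z (fun t => X (u t))].
  move=> u; have [/Xc uc|nuc] := pselect (continuous u).
    by have [z zP] := exists_vantider z0 uc; exists z.
  by exists u => /nuc.
pose y := fix y k : R -> 'cV[R]_n :=
  if k is k'.+1 then fun t => J (y k') `|t| else fun=> z0.
have yc k : continuous (y k).
  elim: k => [|k /JP[] //] /=; first by move=> t; exact: cvg_cst.
have yE k t : 0 <= t -> y k.+1 t = J (y k) t by move=> t0 /=; rewrite ger0_norm.
have y_norm k t : y k `|t| = y k t by case: k => //= k; rewrite normr_id.
pose M := `|X z0|; have M0 : 0 <= M by exact: normr_ge0.
(* Bound for the [k]-th increment. The derivative of [w k.+1] is [L * w k], which is what the
   induction step needs. *)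
pose w (k : nat) t : R := M * 2^-1 ^+ k * expR (2 * L * t).
have wd k b : antider 0 b (w k) (fun t => M * 2^-1 ^+ k * (2 * L * expR (2 * L * t))).
  by apply: antiderZ; exact: antider_expR.
have w0 k t : 0 <= w k t.
  apply: mulr_ge0 (expR_ge0 _); apply: mulr_ge0 (exprn_ge0 _ _) => //.
have wS k t : w k.+1 t = 2^-1 * w k t by rewrite /w exprSr; ring.
have dw k t : 0 <= t -> `|y k.+1 t - y k t| <= w k t.
  elim: k t => [|k IH] t t0.
    have zz : vantider 0 t (fun t => J (y 0%N) t - z0) (fun t => X (y 0%N t) - 0).
      apply: vantiderB; first by case: (JP _ (yc 0%N)).
      by move=> i; under [X in antider _ _ _ X]eq_fun do rewrite mxE; exact: antider_cst.
    rewrite yE //; apply: (vantider_norm_le t0 zz (wd 0%N t)).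
      by have [-> _ _] := JP _ (yc 0%N); rewrite subrr normr0.
    move=> s /andP[s0 _] /=; rewrite subr0 expr0 mulr1 -/M ler_peMr //.
    rewrite (@le_trans _ _ (2 * L)) //; first lra.
    rewrite ler_peMr //; first lra.
    by rewrite -[leLHS]expR0 ler_expR mulr_ge0 ?ltW //; lra.
  have [J0 _ /(_ t) J1] := JP _ (yc k.+1); have [J0' _ /(_ t) J2] := JP _ (yc k).
  rewrite [y k.+2 t]yE // [y k.+1 t]yE //.
  apply: (vantider_norm_le t0 (vantiderB J1 J2) (wd k.+1 t)).
    by rewrite J0 J0' subrr normr0.
  move=> s /andP[s0 _]; rewrite (le_trans (XL _ _)) //.
  rewrite (@le_trans _ _ (L * w k s)) //.
    by rewrite ler_wpM2l ?IH // ltW.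
  by rewrite /w exprSr; lra.
(* A telescoped geometric sum: [w k.+1] is half of [w k], hence [w k = 2 * w k - 2 * w k.+1]. *)
have dwj k j t : 0 <= t -> `|y (k + j)%N t - y k t| <= 2 * w k t - 2 * w (k + j)%N t.
  move=> t0; elim: j => [|j IH]; first by rewrite addn0 !subrr normr0.
  rewrite addnS wS; have := dw (k + j)%N t t0.
  have := ler_normD (y (k + j).+1 t - y (k + j)%N t) (y (k + j)%N t - y k t).
  by rewrite subrKA; lra.
have dwk k m t : (k <= m)%N -> 0 <= t -> `|y m t - y k t| <= 2 * w k t.
  move=> km t0; rewrite -(subnKC km); apply: (le_trans (dwj _ _ _ t0)).
  by rewrite gerBl mulr_ge0.
have wsmall t e : 0 < e -> exists k, 2 * w k t < e.
  move=> e0; have [k H] := half_expn_small (2 * M * expR (2 * L * t)) e0.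
  by exists k; move: H; rewrite /w; lra.
have ycvg t : cvg (y k t @[k --> \oo]).
  apply: cauchy_cvg; apply: cauchy_exP => e e0.
  have [k kP] := wsmall `|t| e e0; exists (y k t).
  exists k => // m /= km; rewrite -ball_normE /= distrC.
  by rewrite -y_norm -(y_norm k) (le_lt_trans (dwk _ _ _ km _)).
pose z t := lim (y k t @[k --> \oo]).
have zy k t : `|z t - y k t| <= 2 * w k `|t|.
  apply/ler_addgt0Pr => e e0.
  have /cvgrPdist_lt/(_ e e0)[m _ mP] := ycvg t.
  have {mP} := mP (maxn k m) (leq_maxr _ _).
  have := dwk k (maxn k m) `|t| (leq_maxl _ _) (normr_ge0 t); rewrite !y_norm.
  have := ler_normD (z t - y (maxn k m) t) (y (maxn k m) t - y k t).
  by rewrite subrKA -/(z t); lra.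
have zc : continuous z.
  move=> t; apply/cvgrPdist_lt => e e0.
  have e30 : 0 < e / 3 by rewrite divr_gt0.
  have [k kP] := wsmall (`|t| + 1) _ e30.
  have := yc k t => /cvgrPdist_lt/(_ _ e30).
  have : \forall s \near t, `|t - s| < 1 by exact: (nbhsx_ballx t 1 ltr01).
  apply: filterS2 => s ts.
  have wle (r : R) : `|r| <= `|t| + 1 -> 2 * w k `|r| < e / 3.
    move=> rt; apply: le_lt_trans kP; rewrite ler_wpM2l // /w.
    rewrite ler_wpM2l ?mulr_ge0 ?exprn_ge0 // ler_expR ler_wpM2l // mulr_ge0 // ltW //.
  have st : `|s| <= `|t| + 1 by have := lerB_dist s t; rewrite [`|s - t|]distrC; lra.
  have := wle _ st; have := wle t; rewrite lerDl ler01 => /(_ isT).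
  have := zy k t; have := zy k s.
  have := ler_normD (z t - y k t) (y k t - y k s).
  have := ler_normD (z t - y k s) (y k s - z s).
  by rewrite !subrKA [`|y k s - z s|]distrC; lra.
have [J0 _ J1] := JP _ zc.
(* [J z] is close to [J (y k)], which is [y k.+1] at nonnegative times and hence close to [z]. *)
have Jz t : 0 <= t -> J z t = z t.
  move=> t0; apply/eqP; rewrite -subr_eq0 -normr_eq0 eq_le normr_ge0 andbT.
  apply/ler_addgt0Pr => e e0; rewrite add0r.
  have [k kP] := wsmall t e e0.
  have [J0' _ J2] := JP _ (yc k).
  have : `|J z t - J (y k) t| <= w k t.
    apply: (vantider_norm_le t0 (vantiderB (J1 t) (J2 t)) (wd k t)).
      by rewrite J0 J0' subrr normr0.
    move=> s /andP[s0 _]; rewrite (le_trans (XL _ _)) //.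
    rewrite (@le_trans _ _ (L * (2 * w k s))) //.
      by rewrite ler_wpM2l ?(ltW L0) //; have := zy k s; rewrite (gtr0_norm s0).
    by rewrite /w; lra.
  have := zy k.+1 t; rewrite yE // wS ger0_norm // distrC.
  have := ler_normD (J z t - J (y k) t) (J (y k) t - z t).
  by rewrite subrKA; lra.
exists (J z) => // b; apply: eq_vantider (J1 b) => t /andP[t0 _].
by rewrite Jz // ltW.
Qed.
End Picard.

(** * Local Lipschitz continuity *)

Section LocallyLipschitz.
Variable R : realType.
Implicit Types V W Z : normedModType R.

Definition loc_lip V W (F : V -> W) (x : V) : Prop :=
  exists r L : R, [/\ 0 < r, 0 <= L & forall y z, `|y - x| < r -> `|z - x| < r ->
    `|F y - F z| <= L * `|y - z|].

Lemma near_norm V (x : V) (P : V -> Prop) : (\forall y \near x, P y) ->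
  exists2 r : R, 0 < r & forall y, `|y - x| < r -> P y.
Proof.
move=> /nbhs_ballP[r /= r0 H]; exists r => // y yx; apply: H.
by rewrite -ball_normE /= distrC.
Qed.

Lemma loc_lip_eq V W (F G : V -> W) x : (\forall y \near x, F y = G y) ->
  loc_lip F x -> loc_lip G x.
Proof.
move=> /near_norm[s s0 FG] [r [L [r0 L0 FL]]]; exists (Num.min r s), L; split=> //.
  by rewrite lt_min r0.
by move=> y z; rewrite !lt_min => /andP[? ?] /andP[? ?]; rewrite -!FG // FL.
Qed.

Lemma loc_lip_comp V W Z (F : W -> Z) (G : V -> W) x :
  loc_lip G x -> loc_lip F (G x) -> loc_lip (fun y => F (G y)) x.
Proof.
move=> [r [L [r0 L0 GL]]] [s [K [s0 K0 FK]]].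
have L1 : 0 < L + 1 by lra.
exists (Num.min r (s / (L + 1))), (K * L); split=> [||y z].
- by rewrite lt_min r0 divr_gt0.
- exact: mulr_ge0.
have Gs u : `|u - x| < Num.min r (s / (L + 1)) -> `|G u - G x| < s.
  rewrite lt_min ltr_pdivlMr // => /andP[ur us].
  have xr : `|x - x| < r by rewrite subrr normr0.
  apply: le_lt_trans us; rewrite (le_trans (GL u x ur xr)) // mulrC ler_wpM2l //.
  by rewrite lerDl.
move=> yx zx; rewrite (le_trans (FK _ _ (Gs _ yx) (Gs _ zx))) //.
move: yx zx; rewrite !lt_min => /andP[? _] /andP[? _].
by rewrite -mulrA ler_wpM2l // GL.
Qed.

Lemma loc_lipD V W (F G : V -> W) x : loc_lip F x -> loc_lip G x ->
  loc_lip (fun y => F y + G y) x.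
Proof.
move=> [r [L [r0 L0 FL]]] [s [K [s0 K0 GK]]].
exists (Num.min r s), (L + K); split=> [||y z].
- by rewrite lt_min r0.
- exact: addr_ge0.
rewrite !lt_min => /andP[yr ys] /andP[zr zs]; rewrite opprD addrACA mulrDl.
by rewrite (le_trans (ler_normD _ _)) // lerD // (FL, GK).
Qed.

Lemma loc_lip_cst V W (c : W) x : loc_lip (fun _ : V => c) x.
Proof. by exists 1, 0; split=> // y z _ _; rewrite subrr normr0 mul0r. Qed.

Lemma loc_lip_sum V W (I : Type) (s : seq I) (F : I -> V -> W) x :
  (forall i, loc_lip (F i) x) -> loc_lip (fun y => \sum_(i <- s) F i y) x.
Proof.
move=> FL; elim: s => [|i s IH].
  by under eq_fun do rewrite big_nil; exact: loc_lip_cst.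
by under eq_fun do rewrite big_cons; exact: loc_lipD.
Qed.

Lemma loc_lipZ V W (a : V -> R) (F : V -> W) x : loc_lip a x -> loc_lip F x ->
  loc_lip (fun y => a y *: F y) x.
Proof.
move=> [r [L [r0 L0 aL]]] [s [K [s0 K0 FK]]].
pose A := `|a x| + L * r; pose B := `|F x| + K * s.
have A0 : 0 <= A by rewrite addr_ge0 // mulr_ge0 // ltW.
have B0 : 0 <= B by rewrite addr_ge0 // mulr_ge0 // ltW.
exists (Num.min r s), (L * B + A * K); split=> [||y z].
- by rewrite lt_min r0.
- by rewrite addr_ge0 // mulr_ge0.
rewrite !lt_min => /andP[yr ys] /andP[zr zs].
have -> : a y *: F y - a z *: F z = (a y - a z) *: F y + a z *: (F y - F z).
  by rewrite scalerBl scalerBr addrA subrK.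
rewrite (le_trans (ler_normD _ _)) // !normrZ mulrDl lerD //.
  rewrite mulrAC ler_pM // ?aL //.
  have xs : `|x - x| < s by rewrite subrr normr0.
  have := FK _ _ ys xs; have := ler_normD (F y - F x) (F x); rewrite subrK /B.
  have : K * `|y - x| <= K * s by rewrite ler_wpM2l // ltW.
  by lra.
rewrite -mulrA ler_pM ?FK //.
have xr : `|x - x| < r by rewrite subrr normr0.
have := aL _ _ zr xr; have := ler_normD (a z - a x) (a x); rewrite subrK /A.
have : L * `|z - x| <= L * r by rewrite ler_wpM2l // ltW.
by lra.
Qed.

Lemma cv_delta n (v : 'cV[R]_n) : v = \sum_k v k 0 *: delta_mx k 0.
Proof.
apply/matrixP => i j; rewrite ord1 summxE (bigD1 i) //= !mxE !eqxx mulr1.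
rewrite big1 ?addr0 // => k ki; rewrite !mxE.
by rewrite (negbTE (_ : i != k)) ?mulr0 // eq_sym.
Qed.

Lemma diff_coord_sum n W (F : 'cV[R]_n -> W) x (v : 'cV[R]_n) :
  'd F x v = \sum_k v k 0 *: 'd F x (delta_mx k 0).
Proof.
by rewrite {1}(cv_delta v) linear_sum; apply: eq_bigr => k _; rewrite linearZ.
Qed.

Lemma is_derive_segment V (F : V -> R) (z v : V) (s : R) :
  differentiable F (z + s *: v) ->
  is_derive s (1 : R) (fun s => F (z + s *: v)) ('d F (z + s *: v) v).
Proof.
move=> dF.
have dp : is_derive s (1 : R) (fun s : R => z + s *: v) v.
  have sv : is_derive s (1 : R) (fun s : R => s *: v) v.
    have lin : linear (fun s : R => s *: v) by move=> a b c; rewrite scalerDl scalerA.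
    pose l : {linear R -> V} := HB.pack (fun s : R => s *: v) (GRing.isLinear.Build _ _ _ _ _ lin).
    have lc : continuous l by move=> t; exact: scalel_continuous.
    have dl : differentiable l s by exact: linear_differentiable.
    apply: DeriveDef; first exact: diff_derivable.
    by rewrite -[LHS]/('D_1 l s) deriveE // (diff_lin s lc) /= scale1r.
  by have := is_deriveD (is_derive_cst z s (1 : R)) sv; rewrite add0r.
have dp' : differentiable (fun s : R => z + s *: v) s.
  by apply/derivable1_diffP; case: dp.
apply: DeriveDef; first by apply: diff_derivable; exact: differentiable_comp.
rewrite deriveE; last exact: differentiable_comp.
rewrite (_ : (fun s => F (z + s *: v)) = F \o (fun s : R => z + s *: v)) //.
rewrite diff_comp //=; congr ('d F _ _).
by rewrite -deriveE //; case: dp.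
Qed.

(** Mean value theorem along the segment between two points, per coordinate of [F]. Since [Ck] gives
    continuity of the differential in fixed directions, the constant [M] sums the norms of the
    partial derivatives at [x], each increased by the 1 that it may gain within the ball. *)
Lemma C1_loc_lip n m (D : set 'cV[R]_n) (F : 'cV[R]_n -> 'cV[R]_m) x :
  open D -> D x -> Ck 1 D F -> loc_lip F x.
Proof.
move=> Dop Dx [dF cF].
have /near_norm[r r0 rP] : \forall y \near x, D y /\
    forall k : 'I_n, `|'d F x (delta_mx k 0) - 'd F y (delta_mx k 0)| < 1.
  apply: filterI; first exact: open_nbhs_nbhs.
  apply: (@filter_forall _ _ (fun k y =>
    `|'d F x (delta_mx k 0) - 'd F y (delta_mx k 0)| < 1) (nbhs x)) => k.
  by have /cvgrPdist_lt/(_ 1 ltr01) := cF (delta_mx k 0) x Dx.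
pose M := \sum_k (`|'d F x (delta_mx k 0)| + 1 : R).
have M0 : 0 <= M by apply: sumr_ge0 => k _; rewrite addr_ge0.
exists r, M; split=> // y z yr zr.
have seg s : 0 <= s <= 1 -> `|z + s *: (y - z) - x| < r.
  move=> /andP[s0 s1].
  have -> : z + s *: (y - z) - x = (1 - s) *: (z - x) + s *: (y - x).
    by rewrite !scalerBr scalerBl !scale1r; apply/matrixP => i j; rewrite !mxE; ring.
  rewrite (le_lt_trans (ler_normD _ _)) // !normrZ [`|s|]ger0_norm // ger0_norm ?subr_ge0 //.
  have : (1 - s) * `|z - x| <= (1 - s) * Num.max `|z - x| `|y - x|.
    by rewrite ler_wpM2l ?subr_ge0 // le_max lexx.
  have : s * `|y - x| <= s * Num.max `|z - x| `|y - x|.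
    by rewrite ler_wpM2l // le_max lexx orbT.
  have : Num.max `|z - x| `|y - x| < r by rewrite gt_max zr.
  by lra.
apply: cv_norm_le => [|i]; first exact: mulr_ge0.
rewrite !mxE.
have dFi s : 0 <= s <= 1 -> differentiable (fun u => F u i 0 : R) (z + s *: (y - z)).
  move=> /seg /rP[/dF dFs _].
  apply: (@differentiable_comp _ _ _ _ F (fun N : 'cV[R]_m => N i 0)) => //.
  exact: differentiable_coord.
have ad : antider 0 1 (fun s => F (z + s *: (y - z)) i 0)
   (fun s => 'd (fun u => F u i 0 : R) (z + s *: (y - z)) (y - z)).
  apply: antider_total => s sI.
    apply: differentiable_continuous; apply/derivable1_diffP.
    by have [] := is_derive_segment (dFi s sI).
  by apply: is_derive_segment; apply: dFi; case/andP: sI => /ltW -> /ltW ->.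
have [c c01] := antider_MVT ltr01 ad.
rewrite scale1r scale0r addr0 subr0 mulr1 [z + _]addrC subrK => ->.
have cI : 0 <= c <= 1 by case/andP: c01 => /ltW -> /ltW ->.
have [Dc Fc] := rP _ (seg c cI).
rewrite -diff_coord; last exact: dF.
apply: (le_trans (mx_norm_coord _ _ _)); rewrite diff_coord_sum.
rewrite (le_trans (ler_norm_sum _ _ _)) // mulr_suml; apply: ler_sum => k _.
rewrite normrZ mulrC ler_pM // ?mx_norm_coord //.
by rewrite -lerBlDl (le_trans (lerB_dist _ _)) // distrC ltW.
Qed.
End LocallyLipschitz.

(** * Solutions and zero dynamics *)

Section Solutions.
Variable R : realType.

Lemma is_derive_coord n (z : R -> 'cV[R]_n) t v i :
  is_derive t (1 : R) z v -> is_derive t (1 : R) (fun s => z s i 0) (v i 0).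
Proof.
move=> [zd <-]; apply: DeriveDef.
  by have /derivable_mxP := zd; apply.
by rewrite derive_mx // mxE.
Qed.

Lemma coord_is_derive n (z : R -> 'cV[R]_n) (t : R) (v : 'cV[R]_n) :
  (forall i, is_derive t (1 : R) (fun s => z s i 0) (v i 0)) ->
  is_derive t (1 : R) z v.
Proof.
move=> zd; have dz : derivable z t 1.
  by apply/derivable_mxP => i j; rewrite ord1; case: (zd i).
apply: DeriveDef => //; rewrite derive_mx //; apply/matrixP => i j.
by rewrite mxE ord1; case: (zd i).
Qed.

Lemma solution_vantider n (D : set 'cV[R]_n) tau X (z : R -> 'cV[R]_n) b :
  solution D tau X z -> (b%:E < tau)%E -> vantider 0 b z (fun t => X t (z t)).
Proof.
move=> [_ zc zd] btau i.
have lt_tau t : t <= b -> (t%:E < tau)%E.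
  by move=> tb; apply: le_lt_trans btau; rewrite lee_fin.
split=> t /andP[t0 tb]; last by apply: is_derive_coord; apply: zd => //; exact/lt_tau/ltW.
have := (subspace_continuousP _ _).1 zc t (conj t0 (lt_tau _ tb)).
move=> /cvgrPdist_lt H; apply/cvgrPdist_lt => e /H.
rewrite !near_withinE; apply: filterS => s st; rewrite /= in_itv/= => /andP[s0 sb].
have := st (conj s0 (lt_tau _ sb)); apply: le_lt_trans.
by have := mx_norm_coord (z t - z s) i 0; rewrite !mxE.
Qed.

Lemma solutionP n (D : set 'cV[R]_n) X (z : R -> 'cV[R]_n) :
  solution D +oo%E (fun=> X) z <->
  (forall t, 0 <= t -> D (z t)) /\ (forall b, vantider 0 b z (fun t => X (z t))).
Proof.
split=> [zs|[zD zz]].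
  split=> [t t0|b]; last by apply: (solution_vantider zs); rewrite ltry.
  by case: zs => zD _ _; apply: zD => //; rewrite ltry.
split=> [t t0 _|| t t0 _].
- exact: zD.
- apply/subspace_continuousP => t [t0 _]; apply/cvgrPdist_lt => e e0.
  (* The interval is extended to [t + 1] so that [t] has room on its right. *)
  have tt : 0 <= t <= t + 1 by rewrite t0 lerDl ler01.
  have [d d0 zd] := vantider_cont (zz (t + 1)) tt e0.
  have m0 : 0 < Num.min d 1 by rewrite lt_min d0 ltr01.
  rewrite near_withinE; apply: filterS (nbhsx_ballx t _ m0) => s st [s0 _].
  move: st; rewrite -ball_normE /= lt_min distrC => /andP[sd s1].
  rewrite distrC; apply: zd => //; rewrite s0 /=.
  by have := ler_norm (s - t); lra.
- apply: coord_is_derive => i; have [_] := zz (t + 1) i; apply.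
  by rewrite t0 ltrDl ltr01.
Qed.

Lemma solution_shift n (D : set 'cV[R]_n) X (z : R -> 'cV[R]_n) s : 0 <= s ->
  solution D +oo%E (fun=> X) z -> solution D +oo%E (fun=> X) (fun t => z (t + s)).
Proof.
move=> s0 /solutionP[zD zz]; apply/solutionP; split=> [t t0|b].
  by apply: zD; rewrite addr_ge0.
apply: (@vantider_shift R n 0 b s z (fun t => X (z t))).
by apply: vantiderW (zz (b + s)) => //; rewrite add0r.
Qed.

Lemma cv_closed_ball_compact n (e : R) : compact [set x : 'cV[R]_n | `|x| <= e].
Proof.
have trmxc : continuous (fun x : 'rV[R]_n => x^T : 'cV[R]_n).
  move=> x A /nbhs_ballP[d d0 dA]; apply/nbhs_ballP; exists d => // y [_ xy].
  by apply: dA; split=> // i j; rewrite !mxE; exact: xy.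
(* For [n = 0] and a negative radius the ball is empty, but the product of segments still contains
   the empty vector. *)
have [e0|e0] := ltP e 0.
  rewrite (_ : mkset _ = set0); first exact: compact0.
  apply/seteqP; split=> x //= xe.
  by have := le_lt_trans (le_trans (normr_ge0 x) xe) e0; rewrite ltxx.
rewrite (_ : mkset _ = (fun x : 'rV[R]_n => x^T : 'cV[R]_n) @`
    [set v : 'rV[R]_n | forall i, `[- e, e]%classic (v 0 i)]).
  apply: continuous_compact; first by apply: continuous_subspaceT => x; exact: trmxc.
  by apply: (@rV_compact R n (fun=> `[- e, e]%classic)) => i; exact: segment_compact.
apply/seteqP; split=> [x xe|_ [v vP <-]] /=.
  exists x^T; last by rewrite trmxK.
  move=> i /=; rewrite mxE in_itv/= -ler_norml.
  exact: le_trans (mx_norm_coord _ _ _) xe.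
apply: cv_norm_le => // i; rewrite mxE ler_norml.
by have := vP i; rewrite /= in_itv.
Qed.
End Solutions.

(** * Zero dynamics: comparison with driven trajectories and uniform attraction time *)

Section ZeroDynamics.
Variables (R : realType) (a b : nat).
Variables (f0 : 'cV[R]_a -> 'cV[R]_b -> 'cV[R]_a) (r L : R).
Hypotheses (r_gt0 : 0 < r) (L_ge0 : 0 <= L).
Hypothesis f0_lip : forall x y x' y',
  `|x| <= r -> `|y| <= r -> `|x'| <= r -> `|y'| <= r ->
  `|f0 x y - f0 x' y'| <= L * (`|x - x'| + `|y - y'|).
Variable D : set 'cV[R]_a.
Notation q := (fun x => f0 x 0).
Hypothesis q_stable : asymptotically_stable D q.
Notation zero_solution := (solution D +oo%E (fun=> q)).

(** The difference [x - z] obeys a Gronwall inequality of rate [L] and forcing L |y|. Dividing by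
    [L + 1] brings both the initial gap and the forcing below the tolerance of [vantider_small]. *)
Lemma perturbation T e : 0 <= T -> 0 < e -> exists2 d : R, 0 < d &
  forall s t (x x' z : R -> 'cV[R]_a) (y : R -> 'cV[R]_b),
  s <= t <= s + T -> vantider s t x x' ->
  (forall u, s < u < t -> x' u = f0 (x u) (y u)) ->
  vantider s t z (fun u => q (z u)) ->
  (forall u, s <= u <= t -> [/\ `|x u| <= r, `|y u| <= r, `|z u| <= r & `|y u| <= d]) ->
  `|x s - z s| <= d -> `|x t - z t| < e.
Proof.
move=> T0 e0; have [d d0 dP] := vantider_small a L_ge0 T0 e0.
have L1 : 0 < L + 1 by rewrite ltr_wpDl.
exists (d / (L + 1)) => [|s t x x' z y st xx xf zz bnd xzs]; first exact: divr_gt0.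
have dLd : d / (L + 1) <= d by rewrite ler_pdivrMr // ler_peMr ?(ltW d0) // lerDr.
have dL0 : 0 <= d / (L + 1) by rewrite divr_ge0 // ltW.
apply: (dP s t (L * (d / (L + 1))) _ _ st (vantiderB xx zz)).
- exact: le_trans dLd.
- rewrite mulr_ge0 //= mulrCA ler_piMr ?(ltW d0) // ler_pdivrMr // mul1r.
  by rewrite lerDl.
- move=> u /andP[su ut]; rewrite xf ?su //.
  have [xr yr zr yd] := bnd u ltac:(by rewrite !ltW).
  apply: (le_trans (f0_lip xr yr zr _)); first by rewrite normr0 ltW.
  by rewrite subr0 mulrDr lerD2l ler_wpM2l.
Qed.

(** Attraction brings the solution from [x0] below [de / 2] at some time [t0]. Solutions from nearby
    points are then below [de] at [t0] by [perturbation], and stability keeps them below [e]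
    afterwards. So one waiting time serves a neighbourhood of [x0], and compactness of the closed
    ball gives a common one. *)
Lemma uniform_attraction : exists s : R, [/\ 0 < s,
  forall x0 : 'cV[R]_a, `|x0| <= s -> exists2 x, zero_solution x & x 0 = x0,
  forall x, zero_solution x -> `|x 0| <= s -> forall t, 0 <= t -> `|x t| <= r &
  forall e : R, 0 < e -> exists2 T : R, 0 <= T & forall x, zero_solution x ->
    `|x 0| <= s -> forall t, T <= t -> `|x t| < e].
Proof.
have [_ _ stab [da da0 [exda attr]]] := q_stable.
have stab' (e : R) : 0 < e -> exists2 d : R, 0 < d & forall x, zero_solution x ->
    `|x 0| < d -> forall t, 0 <= t -> `|x t| < e.
  move=> /stab[d d0 dP]; exists d => // x xs x0 t t0.
  by apply: (dP _ _ xs) => //; rewrite ltry.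
have [dr dr0 drP] := stab' r r_gt0.
(* Halved, so that the closed ball of radius [s] lies in both open balls. *)
pose s := Num.min da dr / 2.
have m0 : 0 < Num.min da dr by rewrite lt_min da0.
have s0 : 0 < s by rewrite divr_gt0.
have sm (x : R) : x <= s -> x < da /\ x < dr.
  move=> xs; have : x < Num.min da dr by rewrite (le_lt_trans xs) // /s; lra.
  by rewrite lt_min => /andP.
exists s; split=> //.
- by move=> x0 /sm[x0a _]; exact: exda.
- by move=> x xs /sm[_ xr] t t0; rewrite ltW //; exact: drP.
move=> e e0; have [de de0 deP] := stab' e e0.
pose P T x0 := forall x, zero_solution x -> x 0 = x0 -> forall t, T <= t -> `|x t| < e.
have cov x0 : `|x0| <= s -> \forall x' \near x0 & T \near +oo, P T x'.
  move=> x0s; have [x0a x0r] := sm _ x0s.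
  have [z zs z0] := exda _ x0a.
  have [t0 t00 zt0] : exists2 t0 : R, 0 <= t0 & `|z t0| < de / 2.
    have /cvgrPdist_lt/(_ (de / 2) ltac:(lra))[t [_ tP]] := attr z zs ltac:(by rewrite z0).
    exists (Num.max 0 (t + 1)); first by rewrite le_max lexx.
    have := tP (Num.max 0 (t + 1)); rewrite sub0r normrN; apply.
    by rewrite lt_max ltrDl ltr01 orbT.
  have [d d0 dP] := perturbation t00 (e := de / 2) ltac:(lra).
  have m'0 : 0 < Num.min d (dr - `|x0|) by rewrite lt_min d0 subr_gt0.
  exists ([set x' | `|x0 - x'| < Num.min d (dr - `|x0|)], [set T | t0 < T]).
    split; last by apply: nbhs_pinfty_gt; exact: num_real.
    by apply: filterS (nbhsx_ballx x0 _ m'0) => y; rewrite -ball_normE.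
  case=> x' T [/= + tT] x xs xx' t Tt; rewrite lt_min => /andP[xd xdr].
  have x'r : `|x 0| < dr.
    by rewrite xx'; have := lerB_dist x' x0; rewrite [`|x' - x0|]distrC; lra.
  have z0r : `|z 0| < dr by rewrite z0.
  have [_ zz] := (solutionP _ _ _).1 zs; have [_ xv] := (solutionP _ _ _).1 xs.
  have : `|x t0 - z t0| < de / 2.
    apply: (dP 0 t0 x _ z (fun=> 0) _ (xv t0) _ (zz t0)) => //.
    - by rewrite add0r t00 lexx.
    - move=> u /andP[u0 _]; rewrite !normr0 !(ltW r_gt0) !(ltW d0); split=> //.
        by rewrite ltW // (drP _ xs).
      by rewrite ltW // (drP _ zs).
    - by rewrite z0 xx' distrC ltW.
  move=> xz; have xt0 : `|x t0| < de.
    by have := lerB_dist (x t0) (z t0); lra.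
  have := deP _ (solution_shift t00 xs); rewrite add0r => /(_ xt0 (t - t0)).
  rewrite subrK; apply; rewrite subr_ge0 (le_trans _ Tt) // ltW //.
(* Near-covering form of compactness: the local waiting times combine into one valid on the whole
   ball. *)
have [M [_ MP]] := (compact_near_coveringP _).1 (@cv_closed_ball_compact R a s) R +oo P _ cov.
exists (Num.max 0 (M + 1)) => [|x xs x0 t Tt]; first by rewrite le_max lexx.
by apply: (MP (Num.max 0 (M + 1)) _ _ x0 x) => //; rewrite lt_max ltrDl ltr01 orbT.
Qed.
End ZeroDynamics.

(** * Asymptotic stability of the cascade *)

Section Clamp.
Variable R : realType.

(** Projection onto the max-norm ball. Being nonexpansive, it turns a Lipschitz bound on the box
    into a global one. *)
Definition clamp (r : R) n (x : 'cV[R]_n) : 'cV[R]_n :=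
  \col_i Num.max (- r) (Num.min r (x i 0)).

Lemma clamp_norm r n (x : 'cV[R]_n) : 0 <= r -> `|clamp r x| <= r.
Proof.
move=> r0; apply: cv_norm_le => // i; rewrite mxE ler_norml.
by rewrite le_max lexx /= ge_max ge_min lexx andbT; lra.
Qed.

Lemma clamp_id r n (x : 'cV[R]_n) : `|x| <= r -> clamp r x = x.
Proof.
move=> xr; apply/matrixP => i j; rewrite ord1 mxE.
have := le_trans (mx_norm_coord x i 0) xr; rewrite ler_norml => /andP[rx xr'].
by rewrite min_r // max_r.
Qed.

Lemma clamp_lip r n (x y : 'cV[R]_n) : `|clamp r x - clamp r y| <= `|x - y|.
Proof.
apply: cv_norm_le => // i; rewrite !mxE.
have := mx_norm_coord (x - y) i 0; rewrite !mxE; apply: le_trans.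
move: (x i 0) (y i 0) => u v; have := ler_norm (u - v).
have := ler_norm (- (u - v)); rewrite normrN ler_norml.
move: `|u - v| => w h1 h2.
by case: (leP r u); case: (leP r v); case: (leP (- r) r); case: (leP (- r) u);
  case: (leP (- r) v) => *; apply/andP; split; lra.
Qed.
End Clamp.

Section Cascade.
Variables (R : realType) (a b : nat).
Variables (f0 : 'cV[R]_a -> 'cV[R]_b -> 'cV[R]_a) (r L : R).
Hypotheses (r_gt0 : 0 < r) (L_ge0 : 0 <= L).
Hypothesis f0_lip : forall x y x' y',
  `|x| <= r -> `|y| <= r -> `|x'| <= r -> `|y'| <= r ->
  `|f0 x y - f0 x' y'| <= L * (`|x - x'| + `|y - y'|).
Variable D : set 'cV[R]_a.
Notation q := (fun x => f0 x 0).
Hypothesis q_stable : asymptotically_stable D q.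
Notation zero_solution := (solution D +oo%E (fun=> q)).

(* The dynamics of [x] is required only inside the box where [f0] is Lipschitz:
   this covers both the field and its globally Lipschitz truncation. *)
Definition driven s t (x x' : R -> 'cV[R]_a) (y : R -> 'cV[R]_b) : Prop :=
  vantider s t x x' /\ forall u, s < u < t -> `|x u| <= r -> `|y u| <= r ->
    x' u = f0 (x u) (y u).

Lemma drivenW s t s' t' x x' y : s <= s' -> t' <= t ->
  driven s t x x' y -> driven s' t' x x' y.
Proof.
move=> ss tt [xx xf]; split; first exact: vantiderW xx.
by move=> u /andP[su ut]; apply: xf; rewrite (le_lt_trans ss) // (lt_le_trans ut).
Qed.

(** The comparison is with the zero solution [z] started at the same point [x s]. Throughout the
    window [z] stays below [e / 2], and at its end it is below [d / 2]; the deviation is below both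
    halves. [first_exit] justifies using the Lipschitz bound along [x]. *)
Lemma driven_window e : 0 < e <= r -> exists d T m : R, [/\ 0 < d, 0 < T, 0 < m &
  forall s t x x' y, s <= t <= s + T -> driven s t x x' y ->
    (forall u, s <= u <= t -> `|y u| <= m) -> `|x s| <= d ->
    `|x t| < e /\ (t = s + T -> `|x t| <= d)].
Proof.
move=> /andP[e0 er].
have [_ _ stab _] := q_stable.
have [d1 d10 d1P] := stab (e / 2) ltac:(lra).
have [s0 [s00 ex _ attr]] := uniform_attraction r_gt0 L_ge0 f0_lip q_stable.
(* Below [d1] for the stability of [z], below [s0] for its existence and attraction, below [e] to
   start under the exit level. *)
pose d := Num.min (Num.min d1 s0) e / 2.
have m0 : 0 < Num.min (Num.min d1 s0) e by rewrite !lt_min d10 s00.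
have d0 : 0 < d by rewrite divr_gt0.
have : d < Num.min (Num.min d1 s0) e by rewrite /d; lra.
rewrite !lt_min => /andP[/andP[dd1 ds0] de].
have [T0 T00 T0P] := attr (d / 2) ltac:(lra).
(* The attraction time may be 0, but windows must have positive length to be iterated. *)
pose T := T0 + 1; have T_gt0 : 0 < T by rewrite /T; lra.
have k0 : 0 < Num.min (e / 2) (d / 2) by rewrite lt_min; lra.
have [m m_gt0 mP] := perturbation r_gt0 L_ge0 f0_lip (ltW T_gt0) k0.
exists d, T, (Num.min m r); split=> //; first by rewrite lt_min m_gt0.
move=> s t x x' y /andP[st tT] [xx xf] ym xs.
have [z zs z0] := ex (x s) ltac:(by rewrite (le_trans xs) // ltW).
have ze u : 0 <= u -> `|z u| < e / 2.
  move=> u0; apply: (d1P _ _ zs) => //; last by rewrite ltry.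
  by rewrite z0 (le_lt_trans xs).
have zz u : vantider s u (fun v => z (v - s)) (fun v => q (z (v - s))).
  have [_ /(_ (u - s)) H] := (solutionP _ _ _).1 zs.
  apply: (@vantider_shift R a s u (- s) z (fun v => q (z v))).
  by rewrite subrr.
have close u : s <= u <= t -> (forall v, s <= v <= u -> `|x v| <= e) ->
    `|x u - z (u - s)| < Num.min (e / 2) (d / 2).
  move=> /andP[su ut] xe.
  apply: (mP s u x x' (fun v => z (v - s)) y _ _ _ (zz u)).
  - by rewrite su (le_trans ut).
  - exact: vantiderW xx.
  - move=> v /andP[sv vu]; have vt := lt_le_trans vu ut; apply: xf; rewrite ?sv //.
      by rewrite (le_trans _ er) // xe // !ltW.
    have svt : s <= v <= t by rewrite !ltW.
    by have := ym v svt; rewrite le_min => /andP[].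
  - move=> v /andP[sv vu].
    have := ym v; rewrite sv (le_trans vu) // => /(_ isT); rewrite le_min => /andP[ym' yr].
    split=> //; first by rewrite (le_trans _ er) // xe // sv.
    rewrite (le_trans (ltW (ze _ _))) ?subr_ge0 //; lra.
  - by rewrite subrr z0 subrr normr0 ltW.
have xe u : s <= u <= t -> `|x u| < e.
  apply: first_exit xx _ _ u; first exact: le_lt_trans de.
  move=> u /[dup] sut /andP[su ut] /(close _ sut).
  rewrite lt_min => /andP[xz _]; have := ze (u - s); rewrite subr_ge0 => /(_ su).
  by have := lerB_dist (x u) (z (u - s)); lra.
split=> [|tE]; first by apply: xe; rewrite st lexx.
have := close t; rewrite st lexx => /(_ isT) H.
have : `|x t - z (t - s)| < Num.min (e / 2) (d / 2).
  by apply: H => v sv; rewrite ltW // xe.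
rewrite lt_min => /andP[_].
have : `|z (t - s)| < d / 2.
  apply: T0P zs _ _ _; first by rewrite z0 (le_trans xs) // ltW.
  by rewrite tE /T; lra.
by have := lerB_dist (x t) (z (t - s)); lra.
Qed.

(** The ball of radius [d] is recovered at every multiple of [T], so the bound of a single window
    holds for all times with the same [m]. *)
Lemma driven_stable e : 0 < e <= r -> exists d m : R, [/\ 0 < d, 0 < m &
  forall t x x' y, 0 <= t -> driven 0 t x x' y ->
    (forall u, 0 <= u <= t -> `|y u| <= m) -> `|x 0| <= d -> `|x t| < e].
Proof.
move=> /driven_window[d [T [m [d0 T0 m0 dP]]]]; exists d, m; split=> //.
move=> t x x' y t0 xy ym x0.
have step k : k%:R * T <= t -> `|x (k%:R * T)| <= d.
  elim: k => [|k IH kt]; first by rewrite mul0r.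
  have kT : k%:R * T <= k.+1%:R * T by rewrite ler_pM2r // ler_nat.
  have kT0 : 0 <= k%:R * T by rewrite mulr_ge0 // ltW.
  have kE : k.+1%:R * T = k%:R * T + T by rewrite -natr1 mulrDl mul1r.
  apply: (dP (k%:R * T) _ x x' y _ _ _ _).2 => //.
  - by rewrite kT kE lexx.
  - exact: drivenW xy.
  - by move=> u /andP[ku ut]; apply: ym; rewrite (le_trans kT0) // (le_trans ut).
  - by apply: IH; exact: le_trans kt.
pose k := Num.truncn (t / T).
have tT0 : 0 <= t / T by rewrite divr_ge0 // ltW.
have /andP[kt tk] : k%:R <= t / T < k.+1%:R by exact: truncn_itv.
move: kt tk; rewrite ler_pdivlMr // ltr_pdivrMr // => kt tk.
have kT0 : 0 <= k%:R * T by rewrite mulr_ge0 // ltW.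
apply: (dP (k%:R * T) t x x' y _ _ _ _).1.
- by rewrite kt -[X in _ + X]mul1r -mulrDl natr1 ltW.
- exact: drivenW xy.
- by move=> u /andP[ku ut]; apply: ym; rewrite (le_trans kT0).
- exact: step.
Qed.

Variable M : 'M[R]_b.
Hypothesis M_bounded : exists2 C : R, 0 <= C & forall t y, 0 <= t ->
  vantider 0 t y (fun s => M *m y s) -> `|y t| <= C * `|y 0|.
Hypothesis M_attracting : forall y : R -> 'cV[R]_b,
  (forall t, vantider 0 t y (fun s => M *m y s)) -> y t @[t --> +oo] --> (0 : 'cV[R]_b).
Variable E : set 'cV[R]_(a + b).
Hypothesis E_box : forall z, `|z| <= r -> E z.
Notation X := (fun z : 'cV[R]_(a + b) =>
  col_mx (f0 (usubmx z) (dsubmx z)) (M *m dsubmx z)).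

Lemma usubmx_vantider s t (z z' : R -> 'cV[R]_(a + b)) : vantider s t z z' ->
  vantider s t (fun u => usubmx (z u)) (fun u => usubmx (z' u)).
Proof.
move=> zz i; under [X in antider _ _ X]eq_fun do rewrite mxE.
by under [X in antider _ _ _ X]eq_fun do rewrite mxE; exact: zz.
Qed.

Lemma dsubmx_vantider s t (z z' : R -> 'cV[R]_(a + b)) : vantider s t z z' ->
  vantider s t (fun u => dsubmx (z u)) (fun u => dsubmx (z' u)).
Proof.
move=> zz i; under [X in antider _ _ X]eq_fun do rewrite mxE.
by under [X in antider _ _ _ X]eq_fun do rewrite mxE; exact: zz.
Qed.

(** Phrased with [driven], so that it also applies to the truncated field, before its solution is
    known to solve the true one. *)
Lemma cascade_stable e : 0 < e -> exists2 d : R, 0 < d &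
  forall t x' (z : R -> 'cV[R]_(a + b)), 0 <= t ->
  driven 0 t (fun u => usubmx (z u)) x' (fun u => dsubmx (z u)) ->
  vantider 0 t (fun u => dsubmx (z u)) (fun u => M *m dsubmx (z u)) ->
  `|z 0| < d -> `|z t| < e.
Proof.
move=> e0; have [C C0 CP] := M_bounded.
pose e1 := Num.min e r.
have e10 : 0 < e1 by rewrite lt_min e0.
have e1e : e1 <= e by rewrite ge_min lexx.
have [|d [m [d0 m0 dP]]] := @driven_stable e1.
  by rewrite e10 ge_min lexx orbT.
have C1 : 0 < C + 1 by rewrite ltr_wpDl.
have me : 0 < Num.min m e1 by rewrite lt_min m0.
exists (Num.min d (Num.min m e1 / (C + 1))) => [|t x' z t0 zx zy].
  by rewrite lt_min d0 divr_gt0.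
rewrite lt_min ltr_pdivlMr // => /andP[zd zm].
have ylt u : 0 <= u <= t -> `|dsubmx (z u)| < Num.min m e1.
  move=> /andP[u0 ut]; apply: le_lt_trans zm.
  apply: (le_trans (CP u _ u0 (vantiderW (lexx _) ut zy))).
  rewrite mulrC ler_pM // ?dsubmx_norm_le //; lra.
have xt : `|usubmx (z t)| < e1.
  apply: (dP _ _ _ _ t0 zx) => [u /ylt|]; first by rewrite lt_min => /andP[/ltW].
  by rewrite (le_trans (usubmx_norm_le _)) // ltW.
have yt : `|dsubmx (z t)| < e1.
  by have := ylt t; rewrite t0 lexx lt_min => /(_ isT)/andP[].
rewrite (@le_lt_trans _ _ (Num.max `|usubmx (z t)| `|dsubmx (z t)|)) //.
  by rewrite -[z t in leLHS]vsubmxK col_mx_norm_le // le_max lexx ?orbT.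
by rewrite gt_max !(lt_le_trans _ e1e).
Qed.

(** The clamped field [X'] is globally Lipschitz, so Picard iteration applies. [cascade_stable] at
    level [r] keeps the solution in the box, where clamping does nothing. *)
Lemma cascade_exists : exists2 d : R, 0 < d & forall z0, `|z0| < d ->
  exists2 z, solution E +oo%E (fun=> X) z & z 0 = z0.
Proof.
have [d d0 dP] := cascade_stable r_gt0; exists d => // z0 z0d.
pose K := L * 2 + b%:R * `|M|.
have K0 : 0 <= b%:R * `|M| by rewrite mulr_ge0.
pose X' (z : 'cV[R]_(a + b)) :=
  col_mx (f0 (clamp r (usubmx z)) (clamp r (dsubmx z))) (M *m dsubmx z).
have X'lip z z' : `|X' z - X' z'| <= K * `|z - z'|.
  rewrite /X' opp_col_mx add_col_mx col_mx_norm_le //.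
    have r0 := ltW r_gt0.
    apply: (le_trans (f0_lip _ _ _ _)); do ?exact: clamp_norm.
    rewrite (@le_trans _ _ (L * 2 * `|z - z'|)) //; last first.
      by rewrite ler_wpM2r // lerDl.
    rewrite -mulrA ler_wpM2l // mulr_natl mulr2n.
    have := clamp_lip r (usubmx z) (usubmx z').
    have := clamp_lip r (dsubmx z) (dsubmx z').
    have := usubmx_norm_le (z - z'); have := dsubmx_norm_le (z - z').
    by rewrite !linearB /=; lra.
  rewrite -mulmxBr (le_trans (mulmx_norm_le _ _)) // -linearB /=.
  by rewrite ler_pM // ?dsubmx_norm_le // /K lerDr mulr_ge0.
have [z zz0 zz] := picard_lindelof z0 X'lip.
have zx t : vantider 0 t (fun u => usubmx (z u))
    (fun u => f0 (clamp r (usubmx (z u))) (clamp r (dsubmx (z u)))).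
  by apply: eq_vantider (usubmx_vantider (zz t)) => u _; rewrite col_mxKu.
have zy t : vantider 0 t (fun u => dsubmx (z u)) (fun u => M *m dsubmx (z u)).
  by apply: eq_vantider (dsubmx_vantider (zz t)) => u _; rewrite col_mxKd.
have zr t : 0 <= t -> `|z t| < r.
  move=> t0; apply: (dP t _ z t0 _ (zy t)); last by rewrite zz0.
  by split; [exact: zx | move=> u _ xr yr; rewrite /= !clamp_id].
exists z => //; apply/solutionP; split=> [t t0|t].
  by apply: E_box; rewrite ltW // zr.
apply: eq_vantider (zz t) => u /andP[u0 _]; have := ltW (zr u (ltW u0)) => zur.
by rewrite /X' !clamp_id // (le_trans _ zur) // (usubmx_norm_le, dsubmx_norm_le).
Qed.

Lemma cascade_driven s z : solution E +oo%E (fun=> X) z ->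
  driven 0 s (fun u => usubmx (z u))
    (fun u => f0 (usubmx (z u)) (dsubmx (z u))) (fun u => dsubmx (z u)) /\
  vantider 0 s (fun u => dsubmx (z u)) (fun u => M *m dsubmx (z u)).
Proof.
move=> /solutionP[_ /(_ s) zz]; split.
  split=> //; apply: eq_vantider (usubmx_vantider zz) => u _.
  by rewrite col_mxKu.
by apply: eq_vantider (dsubmx_vantider zz) => u _; rewrite col_mxKd.
Qed.

Lemma norm_col_le (z : 'cV[R]_(a + b)) e :
  `|usubmx z| <= e -> `|dsubmx z| <= e -> `|z| <= e.
Proof. by move=> ue de; rewrite -[z]vsubmxK col_mx_norm_le. Qed.

(** Once [y] is small, from time [t1] on, a zero solution [w] restarted at the current state is
    followed until it is below [c / 2]. This places [x] within [c] at time [t2], and [driven_stable]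
    restarted there keeps it below [e] forever. *)
Lemma cascade_attracting : exists2 d : R, 0 < d & forall z,
  solution E +oo%E (fun=> X) z -> `|z 0| < d ->
  z t @[t --> +oo] --> (0 : 'cV[R]_(a + b)).
Proof.
have [s0 [s00 ex zr attr]] := uniform_attraction r_gt0 L_ge0 f0_lip q_stable.
have sr0 : 0 < Num.min s0 r by rewrite lt_min s00.
(* Level [s0] keeps every state usable as a start for uniform attraction, level [r] keeps it in the
   Lipschitz box. *)
have [d d0 dP] := cascade_stable sr0; exists d => // z zs z0d.
have zz t := cascade_driven t zs.
have zsr t : 0 <= t -> `|z t| <= s0 /\ `|z t| <= r.
  move=> t0; have := dP t _ z t0 (zz t).1 (zz t).2 z0d.
  by rewrite lt_min => /andP[/ltW ? /ltW].
have xr t : 0 <= t -> `|usubmx (z t)| <= r.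
  by move=> /zsr[_]; apply: le_trans; exact: usubmx_norm_le.
have yr t : 0 <= t -> `|dsubmx (z t)| <= r.
  by move=> /zsr[_]; apply: le_trans; exact: dsubmx_norm_le.
have y0 := M_attracting (fun t => (zz t).2).
apply/cvgrPdist_le => e e0.
have er0 : 0 < Num.min e r by rewrite lt_min e0.
have [|c [m [c0 m0 cP]]] := @driven_stable (Num.min e r).
  by rewrite er0 ge_min lexx orbT.
have c20 : 0 < c / 2 by rewrite divr_gt0.
have [T T0 TP] := attr _ c20.
have [k k0 kP] := perturbation r_gt0 L_ge0 f0_lip T0 c20.
have n0 : 0 < Num.min e (Num.min m k) by rewrite !lt_min e0 m0.
have [t1 t10 yt1] : exists2 t1 : R, 0 <= t1 & forall t, t1 <= t ->
    [/\ `|dsubmx (z t)| <= e, `|dsubmx (z t)| <= m & `|dsubmx (z t)| <= k].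
  have /cvgrPdist_lt/(_ _ n0)[t [_ tP]] := y0.
  exists (Num.max 0 (t + 1)) => [|u]; first by rewrite le_max lexx.
  rewrite ge_max => /andP[_ tu]; have := tP u; rewrite sub0r normrN.
  have tu' : t < u by rewrite (lt_le_trans _ tu) // ltrDl.
  by move=> /(_ tu'); rewrite !lt_min => /and3P[? ? ?]; split; exact: ltW.
pose t2 := t1 + T.
have t12 : t1 <= t2 by rewrite lerDl.
have t20 : 0 <= t2 by exact: le_trans t12.
have x1s : `|usubmx (z t1)| <= s0.
  exact: le_trans (usubmx_norm_le _) (zsr _ t10).1.
have [w ws w0] := ex _ x1s.
have wz : vantider t1 t2 (fun v => w (v - t1)) (fun v => q (w (v - t1))).
  have [_ /(_ (t2 - t1)) H] := (solutionP _ _ _).1 ws.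
  apply: (@vantider_shift R a t1 t2 (- t1) w (fun v => q (w v))).
  by rewrite subrr.
have x2 : `|usubmx (z t2)| <= c.
  have [zx _] := (zz t2).1.
  have : `|usubmx (z t2) - w (t2 - t1)| < c / 2.
    apply: (kP t1 t2 _ _ _ _ _ (vantiderW t10 (lexx _) zx) _ wz).
    - by rewrite t12 lexx.
    - by [].
    - move=> u /andP[t1u _]; have u0 := le_trans t10 t1u.
      split; [exact: xr|exact: yr| |by have [] := yt1 u t1u].
      by apply: zr ws _ _ _; rewrite ?w0 // subr_ge0.
    - by rewrite subrr w0 subrr normr0 ltW.
  have : `|w (t2 - t1)| < c / 2.
    by apply: TP ws _ _ _; rewrite ?w0 // /t2 addrAC subrr add0r.
  by have := lerB_dist (usubmx (z t2)) (w (t2 - t1)); lra.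
exists t2; split=> [|t t2t]; first exact: num_real.
rewrite sub0r normrN; have t2t' := ltW t2t.
have [ye _ _] := yt1 t (le_trans t12 t2t').
apply: norm_col_le => //.
have : `|usubmx (z t)| < Num.min e r.
  rewrite -[t](subrK t2).
  apply: (cP (t - t2) (fun u => usubmx (z (u + t2)))
    (fun u => f0 (usubmx (z (u + t2))) (dsubmx (z (u + t2))))
    (fun u => dsubmx (z (u + t2)))).
  - by rewrite subr_ge0.
  - split=> //; apply: (@vantider_shift R a 0 (t - t2) t2 (fun u => usubmx (z u))
      (fun u => f0 (usubmx (z u)) (dsubmx (z u)))).
    by rewrite add0r subrK; apply: vantiderW (zz t).1.1.
  - move=> u /andP[u0 _]; have [] := yt1 (u + t2) => //.
    by rewrite (le_trans t12) // lerDr.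
  - by rewrite add0r.
by rewrite lt_min => /andP[/ltW].
Qed.

Lemma cascade_asymptotically_stable : asymptotically_stable E X.
Proof.
have [_ q0 _ _] := q_stable.
split.
- by apply: E_box; rewrite normr0 ltW.
- by rewrite !linear0 q0 col_mx0.
(* Solutions with finite [tau] count as well, so the estimate is applied on [0, t] for each t <
   tau. *)
- move=> e e0; have [d d0 dP] := cascade_stable e0; exists d => // tau z zs z0 t t0 tt.
  have zz := solution_vantider zs tt.
  apply: (dP t _ z t0 _ _ z0).
    split; first exact: usubmx_vantider zz.
    by move=> u _ _ _; rewrite /= col_mxKu.
  by apply: eq_vantider (dsubmx_vantider zz) => u _; rewrite col_mxKd.
- have [d1 d10 ex] := cascade_exists; have [d2 d20 attr] := cascade_attracting.
  exists (Num.min d1 d2); first by rewrite lt_min d10.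
  split=> [z0|z zs]; rewrite lt_min => /andP[]; first by move=> /ex.
  by move=> _; exact: attr.
Qed.
End Cascade.

(** * Modal decomposition of a chain of integrators *)

Section SignLemma.
Variable R : realType.
Implicit Types (A l : nat -> R) (t : R).

(** [c k] marks the modes whose sign is opposite to that of [A N]. If mode [N.-1] is marked, every
    marked mode is bounded at the rate of [l N], and exp(l N t) factors out of the condition. If
    not, the marked modes decay at least as fast as mode [N.-1], while the last two modes both count
    positively, and the exponential of [l N.-1] factors out. *)
Lemma modal_sum_gt0 A l N t : 0 <= t ->
  (forall i k, (0 < i)%N -> (i <= k)%N -> (k <= N)%N -> l i <= l k) ->
  A N != 0 -> (0 < N)%N ->
  let c k : R := (A k * A N < 0)%R%:R in
  0 < `|A N| + (1 - c N.-1) * `|A N.-1| - \sum_(1 <= k < N) c k * `|A k| ->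
  0 < A N * \sum_(1 <= k < N.+1) A k * expR (l k * t).
Proof.
move=> t0; case: N => // N lmon AN _ c.
have term i k : (0 < i)%N -> (i <= k)%N -> (k <= N.+1)%N ->
    - (`|A N.+1| * expR (l k * t)) * (c i * `|A i|) <= A N.+1 * (A i * expR (l i * t)).
  move=> i0 ik kN; rewrite /c; case: ltP => [AA|AA].
    have e1 : A N.+1 * A i = - (`|A N.+1| * `|A i|).
      by rewrite mulrC -[LHS]opprK -(ltr0_norm AA) normrM mulrC.
    have e2 : `|A N.+1| * `|A i| * expR (l i * t) <= `|A N.+1| * `|A i| * expR (l k * t).
      by rewrite ler_wpM2l ?mulr_ge0 // ler_expR ler_wpM2r // lmon.
    by rewrite mul1r mulrA e1; lra.
  by rewrite mul0r mulr0 mulrA mulr_ge0 ?expR_ge0 // mulrC.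
have terms m k : (m <= k.+1)%N -> (k <= N.+1)%N ->
    - (`|A N.+1| * expR (l k * t)) * (\sum_(1 <= i < m) c i * `|A i|) <=
    A N.+1 * \sum_(1 <= i < m) A i * expR (l i * t).
  move=> mk kN; rewrite !mulr_sumr !big_nat; apply: ler_sum => i /andP[i0 im].
  by apply: term => //; rewrite -ltnS (leq_trans im).
have AN0 : 0 < `|A N.+1| by rewrite normr_gt0.
move=> p0; rewrite big_nat_recr //= mulrDr.
have sqE : A N.+1 * (A N.+1 * expR (l N.+1 * t)) = `|A N.+1| * expR (l N.+1 * t) * `|A N.+1|.
  by rewrite mulrA -expr2 -real_normK ?num_real // expr2 mulrAC.
(* The number of modes is now [N.+1]: a single mode, [A N] opposite to [A N.+1], or not opposite. *)
have [N0|cN] : N = 0%N \/ c N = 1 \/ (0 < N)%N /\ c N = 0.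
- case: (N) => [|M]; [by left|right]; rewrite /c; case: (_ < _); [by left|by right].
- by rewrite N0 big_geq // mulr0 add0r -N0 sqE !mulr_gt0 // expR_gt0.
case: cN => [cN|[N0 cN]].
  have P0 : 0 < `|A N.+1| * expR (l N.+1 * t) *
     (`|A N.+1| + (1 - c N) * `|A N| - \sum_(1 <= k < N.+1) c k * `|A k|).
    by rewrite mulr_gt0 // mulr_gt0 // expR_gt0.
  have := terms N.+1 N.+1 (leqnSn _) (leqnn _); rewrite sqE.
  by move: P0; rewrite cN subrr mul0r addr0; lra.
have P0 : 0 < `|A N.+1| * expR (l N * t) *
   (`|A N.+1| + (1 - c N) * `|A N| - \sum_(1 <= k < N.+1) c k * `|A k|).
  by rewrite mulr_gt0 // mulr_gt0 // expR_gt0.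
have := terms N N (leqnSn _) (leqnSn _); rewrite sqE.
move: P0; rewrite big_nat_recr //= big_nat_recr //= cN.
have : `|A N.+1| * `|A N| * expR (l N * t) = A N.+1 * (A N * expR (l N * t)).
  rewrite -normrM mulrA ger0_norm // mulrC leNgt; apply/negP => h.
  by move: cN; rewrite /c h => /eqP; rewrite oner_eq0.
have : `|A N.+1| * `|A N.+1| * expR (l N * t) <= `|A N.+1| * `|A N.+1| * expR (l N.+1 * t).
  by rewrite ler_wpM2l ?mulr_ge0 // ler_expR ler_wpM2r // lmon.
by rewrite /= mulrDr; lra.
Qed.

Definition modal_sum N (z0 : 'cV[R]_N) (lam : 'rV[R]_N) t : R :=
  \sum_i (invmx (modal_matrix lam) *m z0) i 0 * expR (lam 0 i * t).

Lemma modal_coefS N (z0 : 'cV[R]_N) (lam : 'rV[R]_N) (i : 'I_N) :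
  modal_coef z0 lam i.+1 = (invmx (modal_matrix lam) *m z0) i 0.
Proof. by rewrite /modal_coef (big_pred1 i). Qed.

Lemma modal_coef0 N (z0 : 'cV[R]_N) (lam : 'rV[R]_N) : modal_coef z0 lam 0 = 0.
Proof. by rewrite /modal_coef big_pred0. Qed.

(** A nonzero last coefficient fixes the sign of the sum at all times. If it vanishes, [pfun]
    reduces to the modulus of the coefficient before it: for [N = 1] this contradicts positivity,
    and for [N = 2] a single exponential remains. *)
Lemma modal_sum_sign N (z0 : 'cV[R]_N) (lam : 'rV[R]_N) (s t : R) :
  (0 < N)%N -> negative_spectrum lam -> 0 < pfun z0 lam ->
  ((2 < N)%N -> modal_coef z0 lam N != 0) -> 0 <= s -> 0 <= t ->
  0 <= modal_sum z0 lam s * modal_sum z0 lam t.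
Proof.
move=> N0 [_ lam_lt] p0 slow s0 t0.
pose A := modal_coef z0 lam.
(* Modes are numbered from 1, hence the predecessor; out of range the value is 0. *)
pose l k : R := if insub k.-1 is Some i then lam 0 i else 0.
have lE (i : 'I_N) : l i.+1 = lam 0 i by rewrite /l /= valK.
have sumE u : modal_sum z0 lam u = \sum_(1 <= k < N.+1) A k * expR (l k * u).
  rewrite /modal_sum big_add1 /= big_mkord; apply: eq_bigr => i _.
  by rewrite /A modal_coefS lE.
have lmon i k : (0 < i)%N -> (i <= k)%N -> (k <= N)%N -> l i <= l k.
  case: i k => // i [//|k] _; rewrite ltnS leq_eqVlt => /predU1P[->//|ik] kN.
  have iN := ltn_trans ik kN.
  by rewrite (lE (Ordinal iN)) (lE (Ordinal kN)) ltW // lam_lt.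
have [AN|AN] := eqVneq (A N) 0; last first.
  have := modal_sum_gt0 t0 lmon AN N0 p0; have := modal_sum_gt0 s0 lmon AN N0 p0.
  rewrite -!sumE => h1 h2; have := mulr_gt0 h1 h2; rewrite mulrACA => h.
  rewrite ltW // -(pmulr_rgt0 _ (_ : 0 < A N * A N)) //.
  by rewrite -expr2 exprn_even_gt0.
have N2 : (N <= 2)%N.
  by rewrite leqNgt; apply/negP => /slow; rewrite -/(A N) AN eqxx.
have NE : N = 2%N.
  apply/eqP; rewrite eqn_leq N2 ltnNge; apply/negP => N1.
  have {}N1 : N = 1%N by apply/eqP; rewrite eqn_leq N1.
  move: p0; rewrite /pfun -/A AN N1 big_geq // /= [A 0%N]modal_coef0 !normr0.
  by rewrite mulr0 addr0 subr0 ltxx.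
have sum2 u : \sum_(1 <= k < 3) A k * expR (l k * u) = A 1%N * expR (l 1%N * u) + A 2%N * expR (l 2%N * u).
  by rewrite big_nat_recr //= big_nat1.
rewrite !sumE; move: AN; rewrite NE => A2.
rewrite !sum2 A2 !mul0r !addr0 mulrACA.
by apply: mulr_ge0; [rewrite -expr2 sqr_ge0 | rewrite mulr_ge0 ?expR_ge0].
Qed.
End SignLemma.

Section Modal.
Variables (R : realType) (N : nat) (lam : 'rV[R]_N).
Hypothesis lamP : negative_spectrum lam.
Notation V := (modal_matrix lam).
Notation A := (chainA R N).
Notation B := (chainB R N).
Notation F := (modal_gain lam).

Lemma modal_matrix_unit : V \in unitmx.
Proof.
rewrite unitmxE det_Vandermonde unitfE; apply/prodf_neq0 => i _.
by apply/prodf_neq0 => j ij; rewrite subr_eq0 gt_eqF //; exact: lamP.2.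
Qed.

(** [A + B *m F] is a companion matrix with eigenvectors (1, lambda, ..., lambda^(N-1)): the shift
    rows multiply each entry by lambda, and the gain is chosen so that the last row produces
    lambda^N. *)
Lemma chain_modal : (A + B *m F) *m V = V *m diag_mx lam.
Proof.
rewrite mulmxDl -mulmxA mulmxKV ?modal_matrix_unit //.
apply/matrixP => k i; rewrite mul_mx_diag !mxE big_ord1 !mxE -exprSr.
have [kN|Nk] := ltnP k.+1 N.
  rewrite (ltn_eqF kN) mul0r addr0 (bigD1 (Ordinal kN)) //= !mxE eqxx mul1r.
  rewrite big1 ?addr0 // => j jk; rewrite !mxE (_ : _ == _ = false) ?mul0r //.
  by apply: contra_neqF jk => /eqP jE; exact: val_inj.
have kE : k.+1 = N by apply/eqP; rewrite eqn_leq Nk ltn_ord.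
rewrite kE eqxx mul1r big1 ?add0r // => j _.
by rewrite !mxE (_ : _ == _ = false) ?mul0r // ltn_eqF // kE.
Qed.

Lemma antider_exp (b k : R) (y : R -> R) : 0 <= b ->
  antider 0 b y (fun t => k * y t) -> y b = y 0 * expR (k * b).
Proof.
move=> b0 yk.
have d0 : antider 0 b (fun t => y t * expR (- k * t)) (fun=> 0).
  by apply: eq_antider (antiderM yk (antider_expR 0 b (- k))) => t _; ring.
have cst := antider_cst 0 b (y 0).
have : y b * expR (- k * b) = y 0.
  apply/eqP; rewrite eq_le; apply/andP; split.
    by apply: antider_le b0 d0 cst _ _ => //; rewrite mulr0 expR0 mulr1.
  by apply: antider_le b0 cst d0 _ _ => //; rewrite mulr0 expR0 mulr1.
by move=> <-; rewrite -mulrA -expRD mulNr addNr expR0 mulr1.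
Qed.

Lemma modal_flow (b : R) (z : R -> 'cV[R]_N) : 0 <= b ->
  vantider 0 b z (fun t => (A + B *m F) *m z t) ->
  z b = V *m \col_i ((invmx V *m z 0) i 0 * expR (lam 0 i * b)).
Proof.
move=> b0 zz; rewrite -[LHS](mulKVmx modal_matrix_unit); congr (_ *m _).
apply/matrixP => i j; rewrite ord1 [RHS]mxE.
apply: (@antider_exp b (lam 0 i) (fun t => (invmx V *m z t) i 0)) => //.
apply: eq_antider (vantiderM (invmx V) zz i) => t _.
have VE : invmx V *m (A + B *m F) = diag_mx lam *m invmx V.
  rewrite -[LHS](mulmxK modal_matrix_unit) -(mulmxA (invmx V)) chain_modal.
  by rewrite mulKmx // modal_matrix_unit.
by rewrite mulmxA VE -mulmxA mul_diag_mx mxE.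
Qed.

Lemma modal_flow_bounded : exists2 C : R, 0 <= C & forall b (z : R -> 'cV[R]_N),
  0 <= b -> vantider 0 b z (fun t => (A + B *m F) *m z t) -> `|z b| <= C * `|z 0|.
Proof.
exists (N%:R * `|V| * (N%:R * `|invmx V|)) => [|b z b0 zz]; first by rewrite !mulr_ge0.
rewrite (modal_flow b0 zz) (le_trans (mulmx_norm_le _ _)) // -[leRHS]mulrA ler_wpM2l ?mulr_ge0 //.
rewrite (le_trans _ (mulmx_norm_le _ _)) //; apply: cv_norm_le => // i.
rewrite mxE normrM -[leRHS]mulr1 ler_pM ?mx_norm_coord //.
rewrite gtr0_norm ?expR_gt0 // -expR0 ler_expR nmulr_rle0 //.
exact: lamP.1.
Qed.

Lemma expR_decay (k : R) : k < 0 -> expR (k * t) @[t --> +oo] --> (0 : R).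
Proof.
move=> k0; apply/cvgrPdist_le => e e0; exists (ln e / k).
split=> [|t lt]; first exact: num_real.
rewrite sub0r normrN ger0_norm ?expR_ge0 // -[leRHS](lnK e0) ler_expR.
by rewrite mulrC -ler_ndivrMr // ltW.
Qed.

Lemma cvg0_sum (I : Type) (s : seq I) (f : I -> R -> R) :
  (forall i, f i t @[t --> +oo] --> (0 : R)) ->
  \sum_(i <- s) f i t @[t --> +oo] --> (0 : R).
Proof.
move=> f0; elim: s => [|i s IH].
  by under eq_fun do rewrite big_nil; exact: cvg_cst.
under eq_fun do rewrite big_cons.
by have := cvgD (f0 i) IH; rewrite addr0; apply.
Qed.

Lemma cvg_modal_sum (al : 'I_N -> R) :
  \sum_i al i * expR (lam 0 i * t) @[t --> +oo] --> (0 : R).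
Proof.
apply: cvg0_sum => i; rewrite -(mulr0 (al i)).
by apply: cvgMr; apply: expR_decay; exact: lamP.1.
Qed.
End Modal.

(** * The closed loop in normal form *)

Section Limits.
Variable R : realType.

Lemma cvgy0_eq (u v : R -> R) : (forall t, 0 <= t -> u t = v t) ->
  v t @[t --> +oo] --> (0 : R) -> u t @[t --> +oo] --> (0 : R).
Proof.
move=> uv v0; apply/cvgrPdist_le => e e0.
have /cvgrPdist_le/(_ e e0) := v0.
apply: filterS2 (nbhs_pinfty_gt (num_real (0 : R))) => t t0.
by rewrite uv // ltW.
Qed.

Lemma cv_cvgy0 n (u : R -> 'cV[R]_n) : (forall i, u t i 0 @[t --> +oo] --> (0 : R)) ->
  u t @[t --> +oo] --> (0 : 'cV[R]_n).
Proof.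
move=> u0; apply/cvgrPdist_le => e e0.
have : \forall t \near +oo, forall i, `|0 - u t i 0| <= e.
  apply: (@filter_forall _ _ (fun i t => `|0 - u t i 0| <= e) (+oo : set_system R)) => i.
  by have /cvgrPdist_le/(_ e e0) := u0 i.
apply: filterS => t H; apply: cv_norm_le => [|i]; first exact: ltW.
by rewrite !mxE.
Qed.

Variables (N : nat) (lam : 'rV[R]_N).
Hypothesis lamP : negative_spectrum lam.

Lemma modal_flow_cvg (z : R -> 'cV[R]_N) :
  (forall b, vantider 0 b z (fun t => (chainA R N + chainB R N *m modal_gain lam) *m z t)) ->
  forall k, z t k 0 @[t --> +oo] --> (0 : R).
Proof.
move=> zz k; pose al i := modal_matrix lam k i * (invmx (modal_matrix lam) *m z 0) i 0.
apply: (@cvgy0_eq _ (fun t => \sum_i al i * expR (lam 0 i * t))); last exact: cvg_modal_sum.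
move=> t t0; rewrite (modal_flow lamP t0 (zz t)) mxE; apply: eq_bigr => i _.
by rewrite /al -mulrA; congr (_ * _); rewrite mxE.
Qed.

(** The first row of the Vandermonde matrix is constant 1, so the output adds up the modes with
    their bare coefficients. *)
Lemma modal_output b (z : R -> 'cV[R]_N) : (0 < N)%N -> 0 <= b ->
  vantider 0 b z (fun t => (chainA R N + chainB R N *m modal_gain lam) *m z t) ->
  (chainC R N *m z b) 0 0 = modal_sum (z 0) lam b.
Proof.
move=> N0 b0 zz; rewrite (modal_flow lamP b0 zz) mulmxA.
rewrite (_ : chainC R N *m _ = const_mx 1); last first.
  apply/matrixP => i j; rewrite !mxE (bigD1 (Ordinal N0)) //= !mxE eqxx mul1r expr0.
  rewrite big1 ?addr0 // => k k0; rewrite !mxE (_ : _ == _ = false) ?mul0r //.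
  by apply: contra_neqF k0 => /eqP kE; exact: val_inj.
by rewrite mxE; apply: eq_bigr => i _; rewrite !mxE mul1r.
Qed.
End Limits.

Section Blocks.
Variables (R : realType) (p m : nat) (gamma : 'I_p -> nat).
Notation Ac := (Ac R gamma).
Notation Bc := (Bc R gamma).
Variables (lam : forall j : 'I_p, 'rV[R]_(gamma j)).
Notation F := (blkdiag_row (fun j => modal_gain (lam j))).
Notation blk i x := (submxcol (x : 'cV[R]_(\sum_j gamma j)) i).

Lemma closed_block (x : 'cV[R]_(\sum_j gamma j)) (v : 'cV[R]_p) j :
  blk j (Ac *m x + Bc *m v) = chainA R (gamma j) *m blk j x + v j 0 *: chainB R (gamma j).
Proof.
rewrite -{1}[x]submxcolK /Defs.Ac /Defs.Bc mul_blkdiag mul_blkdiag_col -mxcolD.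
by rewrite mxcolK.
Qed.

Lemma feedback_block (x : 'cV[R]_(\sum_j gamma j)) j :
  (F *m x) j 0 = (modal_gain (lam j) *m blk j x) 0 0.
Proof. by rewrite -{1}[x]submxcolK mul_blkdiag_row [LHS]mxE. Qed.

Lemma output_block (x : 'cV[R]_(\sum_j gamma j)) j :
  (Cc R gamma *m x) j 0 = (chainC R (gamma j) *m blk j x) 0 0.
Proof. by rewrite -{1}[x]submxcolK mul_blkdiag_row [LHS]mxE. Qed.

Lemma blk_vantider a b (x x' : R -> 'cV[R]_(\sum_j gamma j)) j :
  vantider a b x x' -> vantider a b (fun t => blk j (x t)) (fun t => blk j (x' t)).
Proof.
move=> xx k; under [X in antider _ _ X]eq_fun do rewrite mxE.
by under [X in antider _ _ _ X]eq_fun do rewrite mxE; exact: xx.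
Qed.

Lemma blk_norm_le (x : 'cV[R]_(\sum_j gamma j)) j : `|blk j x| <= `|x|.
Proof. by apply: cv_norm_le => // k; rewrite mxE mx_norm_coord. Qed.

Lemma scale_colE N (c : 'M[R]_1) (B : 'cV[R]_N) : c 0 0 *: B = B *m c.
Proof. by rewrite [in RHS](mx11_scalar c) mul_mx_scalar. Qed.

Variables (S : 'M[R]_m) (Pi : forall j : 'I_p, 'M[R]_(gamma j, m)) (Gam : 'I_p -> 'rV[R]_m).
Hypothesis hreg : forall j, Pi j *m S
  = chainA R (gamma j) *m Pi j + chainB R (gamma j) *m Gam j.
Notation G := (\matrix_(j < p) (Gam j - modal_gain (lam j) *m Pi j)).

(** Substituting the regulator equation for [Pi j *m S] and the feedforward [Gam j] minus gain times
    [Pi j], all terms in [w] regroup into the error. *)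
Lemma regulation_error_flow b (x : R -> 'cV[R]_(\sum_j gamma j)) (w : R -> 'cV[R]_m) j :
  vantider 0 b x (fun t => Ac *m x t + Bc *m (F *m x t + G *m w t)) ->
  vantider 0 b w (fun t => S *m w t) ->
  vantider 0 b (fun t => blk j (x t) - Pi j *m w t)
    (fun t => (chainA R (gamma j) + chainB R (gamma j) *m modal_gain (lam j))
              *m (blk j (x t) - Pi j *m w t)).
Proof.
move=> xx ww; have := vantiderB (blk_vantider (j := j) xx) (vantiderM (Pi j) ww).
apply: eq_vantider => t _; rewrite closed_block.
have -> : (F *m x t + G *m w t) j 0 = (modal_gain (lam j) *m blk j (x t)
    + (Gam j - modal_gain (lam j) *m Pi j) *m w t) 0 0.
  rewrite mxE feedback_block [RHS]mxE; congr (_ + _).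
  by rewrite !mxE; apply: eq_bigr => k _; rewrite mxE.
rewrite scale_colE mulmxA hreg.
rewrite !(mulmxDl, mulmxDr, mulmxBl, mulmxBr, mulmxN, mulNmx) !mulmxA.
by apply/matrixP => i k; rewrite !mxE; ring.
Qed.

Hypothesis lamP : forall j, negative_spectrum (lam j).

Lemma closed_loop_block b (x : R -> 'cV[R]_(\sum_j gamma j)) j :
  vantider 0 b x (fun t => (Ac + Bc *m F) *m x t) ->
  vantider 0 b (fun t => blk j (x t))
    (fun t => (chainA R (gamma j) + chainB R (gamma j) *m modal_gain (lam j))
              *m blk j (x t)).
Proof.
move=> /(blk_vantider (j := j)); apply: eq_vantider => t _.
rewrite mulmxDl -mulmxA closed_block feedback_block scale_colE.
by rewrite mulmxDl mulmxA.
Qed.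

Lemma closed_loop_bounded : exists2 C : R, 0 <= C & forall b x, 0 <= b ->
  vantider 0 b x (fun t => (Ac + Bc *m F) *m x t) -> `|x b| <= C * `|x 0|.
Proof.
have /choice[C CP] : forall j, exists C : R, 0 <= C /\ forall b (z : R -> 'cV[R]_(gamma j)),
  0 <= b -> vantider 0 b z (fun t => (chainA R _ + chainB R _ *m modal_gain (lam j)) *m z t) ->
  `|z b| <= C * `|z 0|.
  by move=> j; have [C C0 H] := modal_flow_bounded (lamP j); exists C.
have C0 : 0 <= \sum_j C j by apply: sumr_ge0 => j _; case: (CP j).
exists (\sum_j C j) => // b x b0 xx.
apply: cv_norm_le => [|i]; first exact: mulr_ge0.
have -> : x b i 0 = blk (tagnat.sig1 i) (x b) (tagnat.sig2 i) 0.
  by rewrite mxE tagnat.sig2K.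
have [C1 CP1] := CP (tagnat.sig1 i).
rewrite (le_trans (mx_norm_coord _ _ _)) //.
rewrite (le_trans (CP1 _ _ b0 (closed_loop_block (j := tagnat.sig1 i) xx))) //.
rewrite ler_pM // ?blk_norm_le // (bigD1 (tagnat.sig1 i)) //= lerDl.
by apply: sumr_ge0 => j _; case: (CP j).
Qed.

Lemma closed_loop_attracting (x : R -> 'cV[R]_(\sum_j gamma j)) :
  (forall b, vantider 0 b x (fun t => (Ac + Bc *m F) *m x t)) ->
  x t @[t --> +oo] --> (0 : 'cV[R]_(\sum_j gamma j)).
Proof.
move=> xx; apply: cv_cvgy0 => i.
have /(_ (tagnat.sig2 i)) := modal_flow_cvg (lamP (tagnat.sig1 i))
  (fun b => closed_loop_block (j := tagnat.sig1 i) (xx b)).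
by under eq_fun do rewrite mxE tagnat.sig2K.
Qed.
End Blocks.

(** * The drift and the trajectories in the coordinates (eta, xi) *)

Section NormalFormField.
Variables (R : realType) (n p : nat).
Variables (f : 'cV[R]_n -> 'cV[R]_n) (g : 'cV[R]_n -> 'M[R]_(n, p)).
Variables (h : 'cV[R]_n -> 'cV[R]_p) (gamma : 'I_p -> nat).
Variables (x0 : 'cV[R]_n) (U : set 'cV[R]_n).
Variable T1 : 'cV[R]_n -> 'cV[R]_(n - \sum_j gamma j).
Variable Tinv : 'cV[R]_(n - \sum_j gamma j + \sum_j gamma j) -> 'cV[R]_n.
Variable f0 : 'cV[R]_(n - \sum_j gamma j) -> 'cV[R]_(\sum_j gamma j) ->
  'cV[R]_(n - \sum_j gamma j).
Hypothesis nf : normal_form f g h x0 U T1 Tinv f0.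
Notation T := (normal_coord f h T1).

(** Rewrites the drift through the whole coordinate map [T], since smoothness is assumed of that map
    rather than of [T1]. *)
Lemma drift_diff x : U x -> f0 (T1 x) (xi_coord f h gamma x) = usubmx ('d T x (f x)).
Proof.
move=> Ux; rewrite (nf_drift nf Ux).
have [/(_ 1%N)[/(_ _ Ux) dT _] _ _ _] := nf_diffeo nf.
have usub_cont : continuous (usubmx : 'cV[R]_(n - \sum_j gamma j + \sum_j gamma j) -> _).
  move=> s A /nbhs_ballP[e e0 es]; apply/nbhs_ballP; exists e => // N [_ MN].
  by apply: es; split => // i j; rewrite !mxE; exact: MN.
rewrite -(diff_linear_comp (f x) usub_cont dT); congr ('d _ x (f x)).
by apply/funext => y; rewrite /= /normal_coord col_mxKu.
Qed.

Lemma loc_lip_nonexp (V W : normedModType R) (F : V -> W) x :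
  (forall y z, `|F y - F z| <= `|y - z|) -> loc_lip F x.
Proof. by move=> Fl; exists 1, 1; split=> // y z _ _; rewrite mul1r. Qed.

(** On the image of [U], the value of [f0] at [z] is the upper part of the differential of [T] at
    [Tinv z], applied to [f (Tinv z)]. Expanded over the basis vectors it is a sum of products of
    C^1 functions, composed with the C^1 map [Tinv]. *)
Lemma drift_loc_lip : smooth setT f -> (T @` U) 0 ->
  loc_lip (fun z => f0 (usubmx z) (dsubmx z)) 0.
Proof.
move=> hf [x Ux Tx]; have [sT oTU TK sTi] := nf_diffeo nf.
have Uop := (nf_nbhs nf).1.
have TU0 : (T @` U) 0 by exists x.
have U0 : U (Tinv 0) by rewrite -Tx TK.
pose D z : 'cV[R]_(n - \sum_j gamma j) :=
  usubmx (\sum_k f z k 0 *: 'd T z (delta_mx k 0)).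
apply: (@loc_lip_eq _ _ _ (fun z => D (Tinv z))).
  apply: filterS (open_nbhs_nbhs (conj oTU TU0)) => _ [y Uy <-].
  rewrite TK // /normal_coord col_mxKu col_mxKd drift_diff //.
  by rewrite [in RHS]diff_coord_sum.
apply: (@loc_lip_comp _ _ _ _ D Tinv).
  exact: (C1_loc_lip oTU TU0 (sTi 1%N)).
apply: (@loc_lip_comp _ _ _ _ usubmx).
  apply: loc_lip_sum => k; apply: loc_lipZ.
    apply: (@loc_lip_comp _ _ _ _ (fun y : 'cV[R]_n => y k 0 : R) f).
      exact: (C1_loc_lip openT I (hf 1%N)).
    by apply: loc_lip_nonexp => y z; have := mx_norm_coord (y - z) k 0; rewrite !mxE.
  (* Order 2 for [T] makes its differential in a fixed direction C^1. *)
  by apply: (C1_loc_lip Uop U0); case: (sT 2%N) => _; apply.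
by apply: loc_lip_nonexp => y z; rewrite -linearB usubmx_norm_le.
Qed.

Lemma drift_box : smooth setT f -> (T @` U) 0 -> exists r L : R, [/\ 0 < r, 0 <= L,
  forall z, `|z| <= r -> (T @` U) z &
  forall x y x' y', `|x| <= r -> `|y| <= r -> `|x'| <= r -> `|y'| <= r ->
    `|f0 x y - f0 x' y'| <= L * (`|x - x'| + `|y - y'|)].
Proof.
move=> hf TU0; have [s [L [s0 L0 fL]]] := drift_loc_lip hf TU0.
have [_ oTU _ _] := nf_diffeo nf.
have /near_norm[s' s'0 H] := open_nbhs_nbhs (conj oTU TU0).
have m0 : 0 < Num.min s s' by rewrite lt_min s0.
pose r := Num.min s s' / 2.
have rlt e : e <= r -> e < s /\ e < s'.
  move=> er; have : e < Num.min s s' by rewrite (le_lt_trans er) // /r; lra.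
  by rewrite lt_min => /andP.
exists r, L; split=> [||z zr|x y x' y' xr yr xr' yr'] //.
- by rewrite divr_gt0.
- by apply: H; rewrite subr0; case: (rlt _ zr).
have := fL (col_mx x y) (col_mx x' y'); rewrite !subr0 !col_mxKu !col_mxKd.
have [h1 _] := rlt _ (col_mx_norm_le xr yr).
have [h2 _] := rlt _ (col_mx_norm_le xr' yr').
move=> /(_ h1 h2)/le_trans; apply; rewrite ler_wpM2l // opp_col_mx add_col_mx.
by rewrite col_mx_norm_le // ?lerDl ?lerDr.
Qed.

Lemma coord_vantider tau (X : R -> 'cV[R]_n -> 'cV[R]_n) (x : R -> 'cV[R]_n) b :
  solution U tau X x -> (b%:E < tau)%E ->
  vantider 0 b (fun t => T (x t)) (fun t => 'd T (x t) (X t (x t))).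
Proof.
move=> [xU xc xd] btau i.
have lt_tau t : t <= b -> (t%:E < tau)%E.
  by move=> tb; apply: le_lt_trans btau; rewrite lee_fin.
have [sT _ _ _] := nf_diffeo nf; have [dT _] := sT 1%N.
split=> t /andP[t0 tb].
  have dTx := dT _ (xU t t0 (lt_tau _ tb)).
  have xt := (subspace_continuousP _ _).1 xc t (conj t0 (lt_tau _ tb)).
  have := cvg_comp x T xt (differentiable_continuous dTx).
  move=> /cvgrPdist_lt H; apply/cvgrPdist_lt => e /H.
  rewrite !near_withinE; apply: filterS => s st; rewrite /= in_itv/= => /andP[s0 sb].
  have := st (conj s0 (lt_tau _ sb)); apply: le_lt_trans.
  by have := mx_norm_coord (T (x t) - T (x s)) i 0; rewrite !mxE.
have tt := lt_tau _ (ltW tb).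
have dTx := dT _ (xU t (ltW t0) tt); have xdt := xd t t0 tt.
have dx : differentiable x t by apply/derivable1_diffP; case: xdt.
apply: (@is_derive_coord R _ (fun t => T (x t)) t _ i).
apply: DeriveDef; first by apply: diff_derivable; exact: differentiable_comp.
rewrite deriveE; last exact: differentiable_comp.
rewrite (_ : (fun t => T (x t)) = T \o x) // diff_comp //=; congr ('d _ _ _).
by rewrite -deriveE //; case: xdt.
Qed.
End NormalFormField.

Unset Implicit Arguments.
Theorem theorem4p1 (R : realType) (n p m : nat)
    (f : 'cV[R]_n -> 'cV[R]_n) (g : 'cV[R]_n -> 'M[R]_(n, p))
    (h : 'cV[R]_n -> 'cV[R]_p)
    (hf : smooth setT f) (hg : smooth setT g) (hh : smooth setT h)
    (x0 : 'cV[R]_n) (gamma : 'I_p -> nat)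
    (hA1 : f 0 = 0)
    (hA2 : relative_degree f g h gamma x0)
    (* the normal form, with stable zero dynamics *)
    (U : set 'cV[R]_n)
    (T1 : 'cV[R]_n -> 'cV[R]_(n - \sum_j gamma j))
    (Tinv : 'cV[R]_(n - \sum_j gamma j + \sum_j gamma j) -> 'cV[R]_n)
    (f0 : 'cV[R]_(n - \sum_j gamma j) -> 'cV[R]_(\sum_j gamma j) ->
          'cV[R]_(n - \sum_j gamma j))
    (hnf : normal_form f g h x0 U T1 Tinv f0)
    (hA3 : asymptotically_stable
             [set eta | (normal_coord f h T1 @` U) (col_mx eta 0)]
             (fun eta => f0 eta 0))
    (* the exosystem and the regulator equations *)
    (S : 'M[R]_m) (H : 'M[R]_(p, m)) (w0 : 'cV[R]_m)
    (Pi : forall j : 'I_p, 'M[R]_(gamma j, m)) (Gam : 'I_p -> 'rV[R]_m)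
    (hreg : forall j, Pi j *m S
                      = chainA R (gamma j) *m Pi j + chainB R (gamma j) *m Gam j)
    (hout : forall j, 0 = chainC R (gamma j) *m Pi j - row j H)
    (* the desired closed-loop spectra *)
    (lam : forall j : 'I_p, 'rV[R]_(gamma j))
    (hlam : forall j, negative_spectrum (lam j))
    (hp : forall j, 0 < pfun (xi_block f h gamma j x0 - Pi j *m w0) (lam j))
    (* Excludes alpha_N = 0 for N = gamma j >= 3, where p > 0 is not sufficient:
       alpha = (-100, 1, 0), lam = (-3, -2, -1) gives p = 1, but
       100 exp(-3t) - exp(-2t) changes sign. *)
    (hslow : forall j, (2 < gamma j)%N ->
       modal_coef (xi_block f h gamma j x0 - Pi j *m w0) (lam j) (gamma j) != 0) :
  let F := blkdiag_row (fun j => modal_gain (lam j)) in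
  let G := \matrix_(j < p) (Gam j - modal_gain (lam j) *m Pi j) in
  let v x w := F *m xi_coord f h gamma x + G *m w in
  let u x w := linearizing_control f g h gamma x (v x w) in
  (* stabilization: w = 0, in the coordinates (eta, xi) *)
  asymptotically_stable (normal_coord f h T1 @` U)
    (fun z => normal_form_field f0 (F *m dsubmx z + G *m 0) z)
  /\
  (* tracking from (x0, w0), along any closed-loop solution on [0, tau[ *)
  (forall (w : R -> 'cV[R]_m) (x : R -> 'cV[R]_n) (tau : \bar R),
     solution setT +oo%E (fun _ wt => S *m wt) w -> w 0 = w0 ->
     solution U tau (fun t xt => f xt + g xt *m u xt (w t)) x -> x 0 = x0 ->
     let e t := H *m w t - h (x t) in
     (tau = +oo%E -> e t @[t --> +oo] --> (0 : 'cV[R]_p)) /\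
     (forall j, ~ changes_sign tau (fun t => e t j 0))).
Proof.
move=> F G v u; set T := normal_coord f h T1.
have gamma_gt0 : forall i, (0 < gamma i)%N by case: hA2.
(* Membership of the origin is part of the stability of the zero dynamics. *)
have TU0 : (T @` U) 0.
  by have [+ _ _ _] := hA3; rewrite /= col_mx0.
split.
  have [r [L [r0 L0 rU lip]]] := drift_box hnf hf TU0.
  (* With [w] zero, the loop is the cascade whose linear block is [Ac + Bc *m F]. *)
  have := cascade_asymptotically_stable r0 L0 lip hA3
    (closed_loop_bounded hlam) (closed_loop_attracting hlam) rU.
  congr asymptotically_stable; apply/funext => z.
  by rewrite /normal_form_field mulmx0 addr0 mulmxDl mulmxA.
move=> w x tau ws wE xs xE e.
pose xi j t := xi_block f h gamma j (x t).
have blkE j t : submxcol (dsubmx (T (x t))) j = xi j t.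
  by rewrite /T /normal_coord col_mxKd /xi_coord mxcolK.
(* Valid at every time before [tau], so it also settles the sign when the solution exists only on a
   finite interval. *)
have eE j t : 0 <= t -> (t%:E < tau)%E -> e t j 0 = - modal_sum
    (xi_block f h gamma j x0 - Pi j *m w0) (lam j) t.
  move=> t0 tt.
  have [xU _ _] := xs.
  have zz := coord_vantider hnf xs tt.
  have zz' : vantider 0 t (fun s => dsubmx (T (x s)))
      (fun s => Ac R gamma *m dsubmx (T (x s)) +
         Bc R gamma *m (F *m dsubmx (T (x s)) + G *m w s)).
    apply: eq_vantider (dsubmx_vantider zz) => s /andP[s0 st].
    have stau : (s%:E < tau)%E by apply: lt_trans tt; rewrite lte_fin.
    have [-> _] := normal_formP hnf gamma_gt0 (xU s (ltW s0) stau) (v (x s) (w s)).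
    rewrite /normal_form_field col_mxKd /v.
    by rewrite /T /normal_coord col_mxKd.
  have ww := solution_vantider ws (ltry t).
  have flow := regulation_error_flow hreg (j := j) zz' ww.
  have := modal_output (hlam j) (gamma_gt0 j) t0 flow.
  rewrite !blkE wE /xi xE => <-.
  have [_ hE] := normal_formP hnf gamma_gt0 (xU t t0 tt) 0.
  rewrite /e mxE hE [X in _ + X]mxE output_block /xi_coord mxcolK.
  (* The second regulator equation turns the output of [Pi j *m w t] into the reference
     component. *)
  rewrite mulmxBr mulmxA (subr0_eq (esym (hout j))).
  rewrite [in RHS]mxE [X in - (_ + X)]mxE opprB; congr (_ - _).
  by rewrite !mxE; apply: eq_bigr => k _; rewrite mxE.
split=> [tauE|j [s [t [s0 st t0 tt]]]].
  apply: cv_cvgy0 => j.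
  apply: (cvgy0_eq (v := fun t => - modal_sum (xi_block f h gamma j x0 - Pi j *m w0) (lam j) t)).
    by move=> t t0; apply: eE => //; rewrite tauE ltry.
  rewrite -oppr0; apply: cvgN; exact: cvg_modal_sum.
rewrite !eE // mulrNN ltNge => /negP; apply.
exact: (modal_sum_sign (gamma_gt0 j) (hlam j) (hp j) (hslow j)).
Qed.
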